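(* Let $k \geq 2$ and $1 \leq i \leq k$ be integers. Define the formal power series $$\tilde{R}_{k,i}(a,b;x;q) = \frac{(-axq,-bxq;q)_{\infty}}{(xq,abxq;q)_{\infty}} \sum_{n \geq 0} \frac{(-ab)^nx^{(k-1)n}q^{kn^2 + (k -i)n -2\binom{n}{2}}(-1/a,-1/b;q)_n(x^2q^2;q^2)_n}{(q^2;q^2)_n(-axq,-bxq;q)_n}\left(1 - \frac{abx^iq^{(2n+1)i - 2n}(1+q^n/a)(1+q^n/b)}{(1+axq^{n+1})(1+bxq^{n+1})} \right),$$ and write $\tilde{R}_{k,i}(a,b;x;q) = \sum_{s,t,m,n \geq 0}\tilde{r}_{k,i}(s,t,m,n)a^sb^tx^mq^n$. Then $\tilde{r}_{k,i}(s,t,m,n)$ equals the number of overpartition pairs $(\lambda,\mu)$ of $n$ with $m$ parts in total, $s$ of which are either overlined and in $\lambda$ or non-overlined and in $\mu$, and $t$ of which are in $\mu$, such that (i) $v_1((\lambda,\mu)) \leq i-1$, (ii) for each $j \geq 1$, $f_j(\lambda) + v_{j+1}((\lambda,\mu)) \leq k-1$, and (iii) for every $j\ge1$ for which equality $f_j(\lambda) + v_{j+1}((\lambda,\mu)) = k-1$ holds in (ii), we have $$jf_j(\lambda) + (j+1)v_{j+1}((\lambda,\mu)) \equiv i-1 + \mathcal{O}_j(\lambda) + \mathcal{O}_j(\mu) \pmod{2}.$$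
   Context: Notation: $(a;q)_n=\prod_{j=0}^{n-1}(1-aq^j)$, $(a;q)_\infty=\prod_{j\ge0}(1-aq^j)$, and $(a_1,\dots,a_r;q)_n=(a_1;q)_n\cdots(a_r;q)_n$. An overpartition is a partition in which the first occurrence of each part size may be overlined; an overpartition pair $(\lambda,\mu)$ of $n$ is a pair of overpartitions whose parts (all positive) sum in total to $n$. For an overpartition $\lambda$, $f_j(\lambda)$ is the number of non-overlined occurrences of $j$ in $\lambda$, $f_{\overline{j}}(\lambda)\in\{0,1\}$ the number of occurrences of $\overline{j}$, and $\mathcal{O}_j(\lambda)$ the number of overlined parts of $\lambda$ that are $\le j$. A positive integer $j$ occurs unattached in $(\lambda,\mu)$ if $j$ occurs in the pair only non-overlined and only in $\mu$. The valuation at $j$ is $v_j((\lambda,\mu)) = f_{j}(\lambda) + f_{\overline{j}}(\lambda) + f_{\overline{j}}(\mu) + \chi(j \text{ occurs unattached in } (\lambda,\mu))$, with $\chi$ the indicator function. *)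

(* Defs.v *)
From HB Require Import structures.
From mathcomp Require Import all_boot all_order all_algebra.
From mathcomp Require Import boolp classical_sets.
From mathcomp Require Import mpoly.

Set Implicit Arguments.
Unset Strict Implicit.
Unset Printing Implicit Defensive.

Import GRing.Theory.
Local Open Scope ring_scope.

(** * Formal power series in one variable q *)

Record fps (R : Type) := FPS { fcoef :> nat -> R }.

HB.instance Definition _ (R : Type) := gen_eqMixin (fps R).
HB.instance Definition _ (R : Type) := gen_choiceMixin (fps R).

Lemma fpsP (R : Type) (f g : fps R) : (forall n, f n = g n) -> f = g.
Proof. by case: f g => [f] [g] /= fg; congr FPS; apply: funext. Qed.

Section FpsRing.
Variable R : comUnitRingType.
Implicit Types f g h : fps R.

Definition fps0 : fps R := FPS (fun=> 0).
Definition fpsC (c : R) : fps R := FPS (fun n => if n == 0%N then c else 0).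
Definition fpsq : fps R := FPS (fun n => (n == 1%N)%:R).
Definition fps_opp f : fps R := FPS (fun n => - f n).
Definition fps_add f g : fps R := FPS (fun n => f n + g n).
Definition fps_mul f g : fps R :=
  FPS (fun n => \sum_(i < n.+1) f i * g (n - i)%N).

Fact fps_addA : associative fps_add.
Proof. by move=> f g h; apply: fpsP => n /=; rewrite addrA. Qed.
Fact fps_addC : commutative fps_add.
Proof. by move=> f g; apply: fpsP => n /=; rewrite addrC. Qed.
Fact fps_add0 : left_id fps0 fps_add.
Proof. by move=> f; apply: fpsP => n /=; rewrite add0r. Qed.
Fact fps_addN : left_inverse fps0 fps_opp fps_add.
Proof. by move=> f; apply: fpsP => n /=; rewrite addNr. Qed.

HB.instance Definition _ :=
  GRing.isZmodule.Build (fps R) fps_addA fps_addC fps_add0 fps_addN.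

Definition fps_trunc N f : {poly R} := \poly_(i < N) f i.

Fact fps_mul_trunc N f g n : (n < N)%N ->
  (fps_mul f g) n = (fps_trunc N f * fps_trunc N g)`_n.
Proof.
move=> ltnN; rewrite coefM /=; apply: eq_bigr => i _.
rewrite !coef_poly (leq_ltn_trans (leq_subr _ _) ltnN).
by rewrite (leq_trans (ltn_ord i) ltnN).
Qed.

Fact fps_mulC : commutative fps_mul.
Proof.
by move=> f g; apply: fpsP => n; rewrite !(fps_mul_trunc _ _ (ltnSn n)) mulrC.
Qed.

Fact fps_mulA : associative fps_mul.
Proof.
move=> f g h; apply: fpsP => n.
rewrite !(fps_mul_trunc _ _ (ltnSn n)).
have E (u v w : fps R) : (fps_trunc n.+1 u * fps_trunc n.+1 (fps_mul v w))`_n =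
    (fps_trunc n.+1 u * (fps_trunc n.+1 v * fps_trunc n.+1 w))`_n.
  rewrite [LHS]coefM [RHS]coefM; apply: eq_bigr => i _; congr (_ * _).
  by rewrite coef_poly ltnS leq_subr (@fps_mul_trunc n.+1) // ltnS leq_subr.
rewrite E [in RHS]mulrC E mulrA; congr (_ `_ _).
by rewrite mulrC.
Qed.

Fact fps_mul1 : left_id (fpsC 1) fps_mul.
Proof.
move=> f; apply: fpsP => n /=; rewrite big_ord_recl /= mul1r subn0.
by rewrite big1 ?addr0 // => i _; rewrite mul0r.
Qed.

Fact fps_mulDl : left_distributive fps_mul fps_add.
Proof.
move=> f g h; apply: fpsP => n /=; rewrite -big_split /=.
by apply: eq_bigr => i _; rewrite mulrDl.
Qed.

Fact fps_1neq0 : fpsC 1 != fps0.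
Proof.
apply/eqP => /(congr1 (fun f : fps R => f 0%N)) /= /eqP.
by rewrite oner_eq0.
Qed.

HB.instance Definition _ :=
  GRing.Zmodule_isComNzRing.Build (fps R)
    fps_mulA fps_mulC fps_mul1 fps_mulDl fps_1neq0.

(* [fps_inv_seq f n] lists the first n coefficients of 1/f when f(0) is
   a unit. *)
Fixpoint fps_inv_seq f n : seq R :=
  if n is m.+1 then
    let s := fps_inv_seq f m in
    rcons s (if m == 0%N then (f 0%N)^-1
             else - (f 0%N)^-1 * \sum_(i < m) f (m - i)%N * s`_i)
  else [::].

Definition fps_unit : pred (fps R) := fun f => f 0%N \is a GRing.unit.
Definition fps_inv f : fps R :=
  if fps_unit f then FPS (fun n => (fps_inv_seq f n.+1)`_n) else f.

Fact size_fps_inv_seq f n : size (fps_inv_seq f n) = n.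
Proof. by elim: n => //= n IHn; rewrite size_rcons IHn. Qed.

Fact nth_fps_inv_seq f n i : (i < n)%N ->
  (fps_inv_seq f n)`_i = (fps_inv_seq f i.+1)`_i.
Proof.
elim: n => // n IHn; rewrite ltnS leq_eqVlt => /predU1P[-> //|ltin].
by rewrite /= nth_rcons size_fps_inv_seq ltin IHn.
Qed.

Fact fps_mulV : {in fps_unit, left_inverse 1 fps_inv *%R}.
Proof.
move=> f Uf; rewrite /fps_inv [fps_unit f]Uf; apply: fpsP => n.
change (\sum_(i < n.+1) (fps_inv_seq f i.+1)`_i * f (n - i)%N =
        if n == 0%N then 1 else 0).
rewrite big_ord_recr /= nth_rcons size_fps_inv_seq ltnn eqxx subnn.
case: n => [|n] /=; first by rewrite big_ord0 add0r mulVr.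
rewrite mulrAC mulNr mulVr // mulN1r; apply/eqP; rewrite subr_eq0; apply/eqP.
apply: eq_bigr => i _; rewrite mulrC; congr (_ * _).
exact/esym/(@nth_fps_inv_seq f n.+1 i).
Qed.

Fact fps_unitP f g : g * f = 1 -> fps_unit f.
Proof.
move=> /(congr1 (fun h : fps R => h 0%N)) /=.
rewrite big_ord1 subnn => gf1; apply/unitrP; exists (g 0%N).
by split; rewrite // mulrC.
Qed.

Fact fps_inv_out : {in [predC fps_unit], fps_inv =1 id}.
Proof. by move=> f /negbTE Nf; rewrite /fps_inv [fps_unit f]Nf. Qed.

HB.instance Definition _ :=
  GRing.ComNzRing_hasMulInverse.Build (fps R) fps_mulV fps_unitP fps_inv_out.

Lemma fps_unitE f : (f \is a GRing.unit) = (f 0%N \is a GRing.unit).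
Proof. by []. Qed.

Lemma fcoefD f g n : (f + g) n = f n + g n. Proof. by []. Qed.
Lemma fcoefN f n : (- f) n = - f n. Proof. by []. Qed.
Lemma fcoefM f g n : (f * g) n = \sum_(i < n.+1) f i * g (n - i)%N.
Proof. by []. Qed.
Lemma fcoef1 n : (1 : fps R) n = if n == 0%N then 1 else 0. Proof. by []. Qed.

(** ** Limits for the q-adic topology (coefficients eventually constant) *)

Definition fps_cvg (u : nat -> fps R) f :=
  forall n, exists N, forall M, (N <= M)%N -> u M n = f n.

Definition fps_lim (u : nat -> fps R) : fps R :=
  FPS (fun n =>
    xget 0 [set c | exists N, forall M, (N <= M)%N -> u M n = c]).

Lemma fps_cvg_lim u f : fps_cvg u f -> fps_lim u = f.
Proof.
move=> uf; apply: fpsP => n /=; case: xgetP => [c _ [N Nc]|noc].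
  have [N' N'f] := uf n.
  by rewrite -(Nc (maxn N N')) ?leq_maxl // N'f ?leq_maxr.
by case: (noc (f n)); apply: uf.
Qed.

Definition fps_series (u : nat -> fps R) : fps R :=
  fps_lim (fun N => \sum_(n < N) u n).

(** ** q-Pochhammer symbols (a; p)_n and (a; p)_oo *)

Definition qpoch (a p : fps R) (n : nat) : fps R :=
  \prod_(j < n) (1 - a * p ^+ j).

Definition qpoch_inf (a p : fps R) : fps R := fps_lim (qpoch a p).

End FpsRing.

Arguments fpsC {R} c.
Arguments fpsq {R}.

(** ** The series R~_{k,i}(a, b; x; q) *)

(* The two truncated subtractions in the exponents of q are exact as soon as
   1 <= i <= k. *)
Definition Rt_term (R : comUnitRingType) (k i : nat) (a b x : fps R) (n : nat)
    : fps R :=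
  let q := fpsq in
  (- (a * b)) ^+ n * x ^+ ((k - 1) * n)
    * q ^+ (k * n ^ 2 + (k - i) * n - 2 * 'C(n, 2))
    * (qpoch (- (1 / a)) q n * qpoch (- (1 / b)) q n)
    * qpoch (x ^+ 2 * q ^+ 2) (q ^+ 2) n
  / (qpoch (q ^+ 2) (q ^+ 2) n
     * (qpoch (- (a * x * q)) q n * qpoch (- (b * x * q)) q n))
  * (1 - a * b * x ^+ i * q ^+ ((2 * n + 1) * i - 2 * n)
           * (1 + q ^+ n / a) * (1 + q ^+ n / b)
         / ((1 + a * x * q ^+ n.+1) * (1 + b * x * q ^+ n.+1))).

Definition Rt (R : comUnitRingType) (k i : nat) (a b x : fps R) : fps R :=
  let q := fpsq in
  qpoch_inf (- (a * x * q)) q * qpoch_inf (- (b * x * q)) q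
    / (qpoch_inf (x * q) q * qpoch_inf (a * b * x * q) q)
  * fps_series (Rt_term k i a b x).

Notation "x %:F" := (FracField.tofrac x) : ring_scope.

(* Since 1/a and 1/b occur, the indeterminates a, b, x live in Q(a, b, x), the
   fraction field of Z[a, b, x], and the ambient ring is Q(a, b, x)[[q]]. *)
Definition abx_frac : fieldType := {fraction {mpoly int[3]}}.

Definition indet (j : 'I_3) : fps abx_frac := fpsC ('X_j : {mpoly int[3]})%:F.

Definition Rt_abx (k i : nat) : fps abx_frac :=
  Rt k i (indet 0) (indet 1) (indet 2%:R).

(* [has_expansion f r] is f = \sum r(s,t,m,n) a^s b^t x^m q^n: the coefficient
   of each q^n is a polynomial in a, b, x with the prescribed coefficients. *)
Definition has_expansion (f : fps abx_frac) (r : nat -> nat -> nat -> nat -> int)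
    : Prop :=
  forall n, exists2 p : {mpoly int[3]}, f n = p%:F &
    forall s t m, p@_[multinom [tuple s; t; m]] = r s t m n.

(** * Overpartition pairs *)

(* The part (j, true) is an overlined j and (j, false) a non-overlined j. Parts
   are listed in weakly decreasing order of size, and a part equal in size to
   the preceding one is not overlined: only the first occurrence may be. *)
Definition overpart_step : rel (nat * bool) := fun y z =>
  ((z.1 < y.1) || (z.1 == y.1) && ~~ z.2)%N.

Definition is_overpartition (l : seq (nat * bool)) : bool :=
  all (fun y => 0 < y.1)%N l && sorted overpart_step l.

Record overpartition := Overpartition {
  parts :> seq (nat * bool);
  partsP : is_overpartition parts
}.

HB.instance Definition _ := [isSub for parts].
HB.instance Definition _ := [Choice of overpartition by <:].

Definition weight (l : overpartition) : nat := sumn [seq y.1 | y <- l].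
Definition fr (l : overpartition) (j : nat) : nat := count_mem (j, false) l.
Definition fr_over (l : overpartition) (j : nat) : nat := count_mem (j, true) l.
Definition num_over (l : overpartition) : nat := count (fun y => y.2) l.
Definition num_nonover (l : overpartition) : nat := count (fun y => ~~ y.2) l.
Definition over_le (l : overpartition) (j : nat) : nat :=
  count (fun y => y.2 && (y.1 <= j)%N) l.

Definition unattached (l m : overpartition) (j : nat) : bool :=
  [&& (0 < fr m j)%N, fr_over m j == 0%N, fr l j == 0%N & fr_over l j == 0%N].

Definition valuation (l m : overpartition) (j : nat) : nat :=
  (fr l j + fr_over l j + fr_over m j + unattached l m j)%N.

Definition pair_statistics (s t m n : nat) (lm : overpartition * overpartition)
    : Prop :=
  let: (la, mu) := lm in
  [/\ (weight la + weight mu = n)%N,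
      (size la + size mu = m)%N,
      (num_over la + num_nonover mu = s)%N &
      size mu = t].

Definition pair_conditions (k i : nat) (lm : overpartition * overpartition)
    : Prop :=
  let: (la, mu) := lm in
  [/\ (valuation la mu 1 <= i - 1)%N,
      (forall j, 1 <= j -> fr la j + valuation la mu j.+1 <= k - 1)%N &
      (forall j, 1 <= j -> fr la j + valuation la mu j.+1 = k - 1 ->
        j * fr la j + j.+1 * valuation la mu j.+1
          = i - 1 + over_le la j + over_le mu j %[mod 2])%N].

(* [A] is a finite set with exactly [N] elements. *)
Definition has_card (T : eqType) (A : T -> Prop) (N : nat) : Prop :=
  exists l : seq T, [/\ uniq l, (forall y, y \in l <-> A y) & size l = N].

(** * Consistency checks: the limits and the expansion above are meaningful *)

Lemma has_expansion_unique f r r' :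
  has_expansion f r -> has_expansion f r' ->
  forall s t m n, r s t m n = r' s t m n.
Proof.
move=> fr fr' s t m n; have [p fp <-] := fr n; have [p' fp' <-] := fr' n.
congr (_@__); apply/eqP; rewrite -tofrac_eq; apply/eqP.
by rewrite -fp -fp'.
Qed.

Lemma has_card_unique (T : eqType) (A : T -> Prop) N N' :
  has_card A N -> has_card A N' -> N = N'.
Proof.
move=> [l [ul lA <-]] [l' [ul' l'A <-]]; apply: perm_size; apply: uniq_perm => //.
by move=> y; apply/idP/idP => [/lA/l'A|/l'A/lA].
Qed.

Section Convergence.
Variable R : comUnitRingType.
Implicit Types (f g : fps R) (u : nat -> fps R).

Lemma fcoef_qXM f N n : (n < N)%N -> (fpsq ^+ N * f) n = 0.
Proof.
elim: N n => // N IHN n ltnN; rewrite exprS -mulrA fcoefM big1 // => -[i lti] _.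
rewrite [X in X * _]/=; case: (i =P 1%N) => [i1|_]; last by rewrite mul0r.
rewrite [X in _ * X]IHN ?mulr0 //= i1.
by case: n ltnN lti => [|n]; rewrite i1 // subn1.
Qed.

Lemma fps_cvg_step u : (forall n, exists f, u n.+1 - u n = fpsq ^+ n * f) ->
  fps_cvg u (fps_lim u).
Proof.
move=> ustep.
have ucst n M : (n < M)%N -> u M n = (u n.+1) n.
  elim: M => // M IHM; rewrite ltnS leq_eqVlt => /predU1P[->//|ltnM].
  rewrite -IHM //; have [f uf] := ustep M.
  by apply/eqP; rewrite -subr_eq0 -fcoefN -fcoefD uf fcoef_qXM.
have uc : fps_cvg u (FPS (fun n => (u n.+1) n)).
  by move=> n; exists n.+1 => M; apply: ucst.
by rewrite (fps_cvg_lim uc).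
Qed.

Lemma qpoch_inf_cvg (a : fps R) : fps_cvg (qpoch a fpsq) (qpoch_inf a fpsq).
Proof.
apply: fps_cvg_step => n; exists (- (qpoch a fpsq n * a)).
rewrite /qpoch big_ord_recr /= mulrBr mulr1 addrAC subrr add0r.
by rewrite mulrN mulrA [in RHS]mulrC.
Qed.

Lemma Rt_series_cvg k i (a b x : fps R) : (2 <= k)%N -> (1 <= i <= k)%N ->
  fps_cvg (fun N => \sum_(n < N) Rt_term k i a b x n)
          (fps_series (Rt_term k i a b x)).
Proof.
move=> k2 /andP[i1 ik]; apply: fps_cvg_step => n.
rewrite big_ord_recr /= addrAC subrr add0r /Rt_term.
have nE : (n <= k * n ^ 2 + (k - i) * n - 2 * 'C(n, 2))%N.
  have le_n : (n <= n ^ 2)%N by case: n => // n; rewrite -mulnn leq_pmull.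
  have le_C : (2 * 'C(n, 2) <= n ^ 2)%N.
    rewrite bin2 -divn2 mulnC (leq_trans (leq_divM _ _)) //.
    by rewrite -mulnn leq_mul // leq_pred.
  have le_D : (2 * 'C(n, 2) + n <= k * n ^ 2 + (k - i) * n)%N.
    apply: leq_trans (leq_addr _ _); apply: leq_trans (leq_mul k2 (leqnn _)).
    by rewrite [leqRHS]mul2n -addnn leq_add.
  by rewrite leq_subRL // (leq_trans (leq_addr n _)).
rewrite -(subnKC nE) exprD.
rewrite [_ ^+ n * _ * (_ * _)]mulrCA -!mulrA.
by eexists; reflexivity.
Qed.

Lemma fcoefM0 f g : (f * g) 0%N = f 0%N * g 0%N.
Proof. by rewrite fcoefM big_ord1. Qed.

Lemma qpoch_unit f p n : qpoch (f * fpsq) p n \is a GRing.unit.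
Proof.
rewrite /qpoch; elim/big_ind: _ => [|u v Uu Uv|j _]; first exact: unitr1.
  by rewrite unitrM Uu.
by rewrite fps_unitE fcoefD fcoefN !fcoefM0 /= mulr0 mul0r subr0 unitr1.
Qed.

Lemma qpoch_inf_unit f : qpoch_inf (f * fpsq) fpsq \is a GRing.unit.
Proof.
have [N /(_ N (leqnn N)) E] := qpoch_inf_cvg (f * fpsq) 0%N.
by rewrite fps_unitE -E -fps_unitE qpoch_unit.
Qed.

Lemma one_plus_unit f n : 1 + f * fpsq ^+ n.+1 \is a GRing.unit.
Proof. by rewrite fps_unitE fcoefD exprSr !fcoefM0 /= !mulr0 addr0 unitr1. Qed.

End Convergence.

Lemma indet_unit j : indet j \is a GRing.unit.
Proof.
rewrite fps_unitE unitfE tofrac_eq0; apply/eqP => /(congr1 (mcoeff U_(j))).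
by rewrite mcoeffX eqxx mcoeff0 => /eqP; rewrite oner_eq0.
Qed.

(* Main.v *)
Require Import Defs.
From mathcomp Require Import all_boot all_order all_algebra.
From mathcomp Require Import mpoly ring zify.

(** Write y = xq and R_i(x) for the series.  Up to the common infinite product,
    every summand of R_i(x) and of R_j(xq) is an explicit multiple of one
    sequence c_n(x) ([core]), and the first order recurrence of c_n makes the
    following relations hold summand by summand, up to telescoping terms:
      R_1(x) = R_k(xq),
      (1 - aby) R_2(x) = (1 + y) R_{k-1}(xq) + (a + b) y R_k(xq),
      (1 - aby) (R_i(x) - R_{i-2}(x)) = y^{i-2} (1 + y)
        (R_{k-i+1}(xq) + (a + b) R_{k-i+2}(xq) + ab R_{k-i+3}(xq))  (3 <= i <= k).
    They sum up to the single relation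
      R_i(x) = sum over the multiplicities h of the part 1 in (lambda, mu) with
               v_1 <= i - 1 of weight(h) R_{i'}(xq),  i' depending on k, i, h,
    which says that R_i counts overpartition pairs by removing the parts equal
    to 1 and decreasing all other parts by 1.  Since R_i(x q^N) = 1 modulo
    q^{N+1}, iterating it determines all the coefficients. *)

Set Implicit Arguments.
Unset Strict Implicit.
Unset Printing Implicit Defensive.

Import GRing.Theory.
Local Open Scope ring_scope.

(** * Congruences modulo powers of q *)

Section Congruence.
Variable R : comUnitRingType.
Implicit Types (f g h u v z : fps R) (w : nat -> fps R).

Notation q := (@fpsq R).

Definition eqmodq N f g := forall n, (n < N)%N -> f n = g n.

(** Identities between infinite sums and products are proved through this: modulo each power of q
    both sides may be replaced by finite ones. *)
Lemma eqmodq_eq f g : (forall N, eqmodq N f g) -> f = g.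
Proof. by move=> fg; apply: fpsP => n; apply: (fg n.+1). Qed.

Lemma eqmodq_refl N f : eqmodq N f f. Proof. by []. Qed.

Lemma eqmodq_sym N f g : eqmodq N f g -> eqmodq N g f.
Proof. by move=> fg n /fg. Qed.

Lemma eqmodq_trans N g f h : eqmodq N f g -> eqmodq N g h -> eqmodq N f h.
Proof. by move=> fg gh n lt_nN; rewrite fg ?gh. Qed.

Lemma eqmodqW N M f g : (M <= N)%N -> eqmodq N f g -> eqmodq M f g.
Proof. by move=> leMN fg n ltnM; apply: fg; apply: leq_trans leMN. Qed.

Lemma eqmodqD N f g u v :
  eqmodq N f g -> eqmodq N u v -> eqmodq N (f + u) (g + v).
Proof. by move=> fg uv n ltnN; rewrite !fcoefD fg ?uv. Qed.

Lemma eqmodqN N f g : eqmodq N f g -> eqmodq N (- f) (- g).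
Proof. by move=> fg n ltnN; rewrite !fcoefN fg. Qed.

Lemma eqmodqM N f g u v :
  eqmodq N f g -> eqmodq N u v -> eqmodq N (f * u) (g * v).
Proof.
move=> fg uv n ltnN; rewrite !fcoefM; apply: eq_bigr => i _.
rewrite fg ?uv //; first exact: leq_ltn_trans (leq_subr _ _) ltnN.
exact: leq_trans (ltn_ord i) ltnN.
Qed.

Lemma eqmodq_sum N (I : Type) (r : seq I) (P : pred I) (F G : I -> fps R) :
  (forall j, P j -> eqmodq N (F j) (G j)) ->
  eqmodq N (\sum_(j <- r | P j) F j) (\sum_(j <- r | P j) G j).
Proof.
by move=> FG; elim/big_ind2: _ => // *; apply: eqmodqD.
Qed.

Lemma eqmodq_qX N M f : (N <= M)%N -> eqmodq N (q ^+ M * f) 0.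
Proof. by move=> leNM n ltnN; rewrite fcoef_qXM // (leq_trans ltnN). Qed.

Lemma eqmodqV N f g : f \is a GRing.unit -> g \is a GRing.unit ->
  eqmodq N f g -> eqmodq N f^-1 g^-1.
Proof.
move=> Uf Ug fg.
have -> : f^-1 = f^-1 * (g * g^-1) by rewrite mulrV ?mulr1.
rewrite -[X in eqmodq _ _ X](mulKr Uf).
by do 2![apply: eqmodqM => //]; apply: eqmodq_sym.
Qed.

(** From index N on every step is divisible by q^N, so the coefficients below N no longer change. *)
Lemma fps_lim_modq w N : (forall n, exists f, w n.+1 - w n = q ^+ n * f) ->
  eqmodq N (fps_lim w) (w N).
Proof.
move=> wstep n ltnN; have [M wM] := fps_cvg_step wstep n.
rewrite -(wM (maxn M N)) ?leq_maxl //.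
have: (N <= maxn M N)%N by apply: leq_maxr.
elim: (maxn M N) => [|L IHL]; first by rewrite leqn0 => /eqP->.
rewrite leq_eqVlt => /predU1P[-> //|ltNL].
rewrite -IHL //; have [f wf] := wstep L.
have -> : w L.+1 = w L + q ^+ L * f by rewrite -wf addrC subrK.
by rewrite fcoefD fcoef_qXM ?addr0 //; apply: leq_trans ltnN _.
Qed.

Lemma qpochS z p n : qpoch z p n.+1 = qpoch z p n * (1 - z * p ^+ n).
Proof. by rewrite /qpoch big_ord_recr. Qed.

Lemma qpochSl z p n : qpoch z p n.+1 = (1 - z) * qpoch (z * p) p n.
Proof.
rewrite /qpoch big_ord_recl expr0 mulr1; congr (_ * _).
by apply: eq_bigr => i _; rewrite -mulrA -exprS.
Qed.

Lemma qpoch_inf_modq z N : eqmodq N (qpoch_inf z q) (qpoch z q N).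
Proof.
apply: fps_lim_modq => n; exists (- (qpoch z q n * z)).
by rewrite qpochS; ring.
Qed.

Lemma qpoch_inf_rec z : qpoch_inf z q = (1 - z) * qpoch_inf (z * q) q.
Proof.
apply: eqmodq_eq => N.
apply: eqmodq_trans (eqmodqW (leqnSn _) (@qpoch_inf_modq z N.+1)) _.
by rewrite qpochSl; apply: eqmodqM => //; apply/eqmodq_sym/qpoch_inf_modq.
Qed.

Lemma qpoch_inf_qX z N : eqmodq N (qpoch_inf (z * q ^+ N) q) 1.
Proof.
apply: eqmodq_trans (@qpoch_inf_modq _ N) _.
(* Only the number of factors is generalized; the N of the modulus and of the argument stays
   fixed. *)
elim: {3}N => [|n IHn]; first by rewrite /qpoch big_ord0.
rewrite qpochS -[X in eqmodq _ _ X]mulr1; apply: eqmodqM => //.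
have -> : 1 - z * q ^+ N * q ^+ n = 1 + q ^+ N * (- (z * q ^+ n)) by ring.
by rewrite -[X in eqmodq _ _ X]addr0; apply: eqmodqD => //; apply: eqmodq_qX.
Qed.

End Congruence.

(** * The sequence c_n *)

Lemma bin2_double n : (2 * 'C(n, 2) + n = n ^ 2)%N.
Proof. by elim: n => // n IHn; rewrite binS bin1; lia. Qed.

Lemma unit_mulI (R : unitRingType) (u x y : R) :
  u \is a GRing.unit -> x * u = y * u -> x = y.
Proof. by move=> Uu; apply: mulIr. Qed.

Section CoreSequence.
Variables (R : comUnitRingType) (k : nat) (a b : fps R).
Hypotheses (Ua : a \is a GRing.unit) (Ub : b \is a GRing.unit).
Implicit Type x : fps R.

Notation q := (@fpsq R).

Definition prefactor x : fps R :=
  qpoch_inf (- (a * x * q)) q * qpoch_inf (- (b * x * q)) q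
    / (qpoch_inf (x * q) q * qpoch_inf (a * b * x * q) q).

(** The part of [Rt_term] that does not depend on i. The symbols in -axq and -bxq have n + 1
    factors, so they absorb the denominator of the last bracket of [Rt_term]. *)
Definition core x n : fps R :=
  (- (a * b)) ^+ n * x ^+ ((k - 1) * n) * q ^+ ((k - 1) * n ^ 2)
    * (qpoch (- (1 / a)) q n * qpoch (- (1 / b)) q n)
    * qpoch (x ^+ 2 * q ^+ 2) (q ^+ 2) n
  / (qpoch (q ^+ 2) (q ^+ 2) n
     * (qpoch (- (a * x * q)) q n.+1 * qpoch (- (b * x * q)) q n.+1)).

Lemma one_minus_unit (f : fps R) n : 1 - f * q ^+ n.+1 \is a GRing.unit.
Proof. by rewrite -mulNr one_plus_unit. Qed.

Lemma qpochN_unit f n : qpoch (- (f * q)) q n \is a GRing.unit.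
Proof. by rewrite -mulNr qpoch_unit. Qed.

Lemma qpochNS f n :
  qpoch (- (f * q)) q n.+1 = qpoch (- (f * q)) q n * (1 + f * q ^+ n.+1).
Proof. by rewrite qpochS mulNr opprK -mulrA -exprS. Qed.

Lemma qpoch_divS c n : c \is a GRing.unit ->
  c * qpoch (- (1 / c)) q n.+1 = qpoch (- (1 / c)) q n * (c + q ^+ n).
Proof.
move=> Uc; rewrite qpochS; move: (qpoch _ _ _) (q ^+ n) => u v.
by ring: (mulrV Uc).
Qed.

(** Each of the four infinite products loses its first factor under x -> xq. *)
Lemma prefactor_shift x :
  prefactor (x * q) * ((1 + a * x * q) * (1 + b * x * q))
  = prefactor x * ((1 - x * q) * (1 - a * b * x * q)).
Proof.
rewrite /prefactor (qpoch_inf_rec (- (a * x * q))) (qpoch_inf_rec (- (b * x * q))).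
rewrite (qpoch_inf_rec (x * q)) (qpoch_inf_rec (a * b * x * q)) !opprK !mulNr.
rewrite !mulrA.
have U1 := qpoch_inf_unit (x * q); have U2 := qpoch_inf_unit (a * b * x * q).
have V1 : 1 - x * q \is a GRing.unit by apply: (one_minus_unit x 0).
have V2 : 1 - a * b * x * q \is a GRing.unit.
  by apply: (one_minus_unit (a * b * x) 0).
(* Products and powers become opaque variables here, as in the proofs below; [ring] then needs only
   the supplied relations. *)
move: (qpoch_inf (- _) _) (qpoch_inf (- _) _) U1 U2 => A B.
move: (qpoch_inf _ _) (qpoch_inf _ _) => C D UC UD.
move: (1 - _) (1 - _) V1 V2 => c d Uc Ud.
rewrite !invrM ?unitrM ?Uc ?Ud ?UC ?UD //.
by ring: (mulrV Uc) (mulrV Ud).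
Qed.

Lemma term_core x n i : (1 <= i <= k)%N ->
  Rt_term k i a b x n = core x n *
   (q ^+ (n + (k - i) * n) * ((1 + a * x * q ^+ n.+1) * (1 + b * x * q ^+ n.+1))
    - x ^+ i * q ^+ ((k - 1) * n + i * n.+1) * ((a + q ^+ n) * (b + q ^+ n))).
Proof.
move=> /andP[i1 ik]; rewrite /Rt_term /core !qpochNS.
(* As 2 * 'C(n, 2) = n^2 - n, the exponent splits into the one kept in [core] and a part linear in
   n. *)
have -> : (k * n ^ 2 + (k - i) * n - 2 * 'C(n, 2)
           = (k - 1) * n ^ 2 + (n + (k - i) * n))%N.
  have := bin2_double n; move: ('C(n, 2)) => c cE.
  have [d ->] : exists d, k = d.+1 by exists (k - 1)%N; lia.
  by move: (d.+1 - i)%N => e; rewrite subn1 /=; nia.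
have -> : ((k - 1) * n + i * n.+1
           = (n + (k - i) * n) + ((2 * n + 1) * i - 2 * n))%N.
  have [d ->] : exists d, k = (i + d)%N by exists (k - i)%N; lia.
  by case: i {ik} i1 => // i _; nia.
rewrite !(exprD q).
have Uw := qpoch_unit q (q ^+ 2) n; rewrite -expr2 in Uw.
have UA := qpochN_unit (a * x) n; have UB := qpochN_unit (b * x) n.
have Ual := one_plus_unit (a * x) n; have Ube := one_plus_unit (b * x) n.
move: (qpoch (- (a * x * _)) _ _) (qpoch (- (b * x * _)) _ _) UA UB => A B UA UB.
move: (qpoch _ _ _) (qpoch _ _ _) => A' B'.
move: (qpoch _ _ _) (qpoch _ _ _) Uw => V W UW.
move: (1 + a * _ * _) (1 + b * _ * _) Ual Ube => al be Ual Ube.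
rewrite !invrM ?unitrM ?UA ?UB ?Ual ?Ube ?UW //.
move: (q ^+ _) (q ^+ _) (q ^+ _) (q ^+ n) => q1 q2 q3 q4.
move: (x ^+ _) (x ^+ _) (_ ^+ n) => x1 x2 x3.
by ring: (mulrV Ual) (mulrV Ube) (mulrV Ua) (mulrV Ub).
Qed.

(** The ratio of consecutive terms with denominators cleared: each symbol gains one factor, and
    (n+1)^2 - n^2 = 2n + 1. *)
Lemma core_next x n :
  core x n.+1 * ((1 + a * x * q ^+ n.+2) * (1 + b * x * q ^+ n.+2))
    * (1 - q ^+ (2 * n.+1))
  = - (core x n * x ^+ (k - 1) * q ^+ ((k - 1) * (2 * n + 1))
       * ((a + q ^+ n) * (b + q ^+ n)) * (1 - x ^+ 2 * q ^+ (2 * n.+1))).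
Proof.
rewrite /core (qpochNS (a * x) n.+1) (qpochNS (b * x) n.+1).
have -> : ((k - 1) * n.+1 ^ 2 = (k - 1) * n ^ 2 + (k - 1) * (2 * n + 1))%N.
  by rewrite -mulnDr; congr (_ * _)%N; lia.
have -> : ((k - 1) * n.+1 = (k - 1) * n + (k - 1))%N by rewrite mulnS addnC.
rewrite 2!exprD [_ ^+ n.+1]exprSr.
have EA := qpoch_divS n Ua; have EB := qpoch_divS n Ub.
(* The new factor ab is shared between the symbols in -1/a and -1/b, to match [EA] and [EB]. *)
have -> : (- (a * b)) ^+ n * - (a * b)
   * (x ^+ ((k - 1) * n) * x ^+ (k - 1))
   * (q ^+ ((k - 1) * n ^ 2) * q ^+ ((k - 1) * (2 * n + 1)))
   * (qpoch (- (1 / a)) q n.+1 * qpoch (- (1 / b)) q n.+1)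
  = - ((- (a * b)) ^+ n * (x ^+ ((k - 1) * n) * x ^+ (k - 1))
   * (q ^+ ((k - 1) * n ^ 2) * q ^+ ((k - 1) * (2 * n + 1)))
   * ((a * qpoch (- (1 / a)) q n.+1) * (b * qpoch (- (1 / b)) q n.+1))).
  by ring.
rewrite EA EB {EA EB}.
rewrite !(qpochS _ (q ^+ 2)) -(mulrA _ (q ^+ 2)) -exprS -exprM.
have Uw := qpoch_unit q (q ^+ 2) n; rewrite -expr2 in Uw.
have Uw1 : 1 - q ^+ (2 * n.+1) \is a GRing.unit.
  by have := one_minus_unit 1 (2 * n).+1; rewrite mul1r mulnS.
have UA := qpochN_unit (a * x) n.+1; have UB := qpochN_unit (b * x) n.+1.
have Ual := one_plus_unit (a * x) n.+1; have Ube := one_plus_unit (b * x) n.+1.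
move: (qpoch (- (a * x * _)) _ _) (qpoch (- (b * x * _)) _ _) UA UB => A B UA UB.
move: (qpoch (- _) _ _) (qpoch (- _) _ _) => A' B'.
move: (qpoch _ _ _) (qpoch _ _ _) Uw => V W UW.
move: (1 + a * _ * _) (1 + b * _ * _) Ual Ube => al be Ual Ube.
move: (1 - x ^+ _ * _) (1 - q ^+ _) Uw1 => w2 w1 Uw1.
rewrite !invrM ?unitrM ?UA ?UB ?Ual ?Ube ?UW ?Uw1 //.
move: (q ^+ n) (q ^+ _) (q ^+ _) => q1 q2 q3.
move: (x ^+ _) (x ^+ _) (_ ^+ n) => x1 x2 x3.
by ring: (mulrV Ual) (mulrV Ube) (mulrV Uw1).
Qed.

(** Shifting [core] leaves a denominator 1 - x^2 q^2 = (1 - xq)(1 + xq). The factor 1 - xq is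
    supplied by [prefactor_shift], and 1 + xq stays on the left. *)
Lemma prefactor_core_shift x n :
  prefactor (x * q) * core (x * q) n * (1 + x * q)
    * ((1 + a * x * q ^+ n.+2) * (1 + b * x * q ^+ n.+2))
  = prefactor x * core x n * (1 - a * b * x * q) * q ^+ ((k - 1) * n)
    * (1 - x ^+ 2 * q ^+ (2 * n.+1)).
Proof.
have E : core (x * q) n * ((1 + a * x * q ^+ n.+2) * (1 + b * x * q ^+ n.+2))
    * (1 - x ^+ 2 * q ^+ 2)
  = core x n * ((1 + a * x * q) * (1 + b * x * q))
    * q ^+ ((k - 1) * n) * (1 - x ^+ 2 * q ^+ (2 * n.+1)).
  (* Shifting the argument drops the first factor and appends a new last one. *)
  have shiftA c : qpoch (- (c * (x * q) * q)) q n.+1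
      * (1 + c * x * q) = qpoch (- (c * x * q)) q n.+1
      * (1 + c * x * q ^+ n.+2).
    by rewrite -qpochNS [RHS]qpochSl opprK mulrC mulNr !mulrA.
  have shiftV : qpoch ((x * q) ^+ 2 * q ^+ 2) (q ^+ 2) n * (1 - x ^+ 2 * q ^+ 2)
      = qpoch (x ^+ 2 * q ^+ 2) (q ^+ 2) n * (1 - x ^+ 2 * q ^+ (2 * n.+1)).
    rewrite mulnS [in RHS]exprD exprM mulrA -qpochS qpochSl mulrC exprMn.
    by rewrite mulrA.
  have shiftVA c : (1 + c * x * q ^+ n.+2) / qpoch (- (c * (x * q) * q)) q n.+1
      = (1 + c * x * q) / qpoch (- (c * x * q)) q n.+1.
    have U1 := qpochN_unit (c * x) n.+1; have U2 := qpochN_unit (c * (x * q)) n.+1.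
    apply: (unit_mulI U1); apply: (unit_mulI U2).
    rewrite mulrAC divrK // mulrC -shiftA; move: (qpoch _ _ _) (qpoch _ _ _) U1 U2.
    by move=> A B UA UB; ring: (mulrV UA) (mulrV UB).
  move: shiftV (shiftVA a) (shiftVA b).
  have UA := qpochN_unit (a * x) n.+1; have UB := qpochN_unit (b * x) n.+1.
  have UA' := qpochN_unit (a * (x * q)) n.+1.
  have UB' := qpochN_unit (b * (x * q)) n.+1.
  have Uw := qpoch_unit q (q ^+ 2) n; rewrite -expr2 in Uw.
  rewrite /core [(x * q) ^+ (_ * n)]exprMn !invrM ?unitrM ?UA ?UB ?UA' ?UB' ?Uw //.
  move: (qpoch (- (a * x * _)) _ _) (qpoch (- (b * x * _)) _ _) => A B.
  move: (qpoch (- (a * _ * _)) _ _) (qpoch (- (b * _ * _)) _ _) => A' B'.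
  move: (qpoch (- _) _ _) (qpoch (- _) _ _) => A1 B1.
  move: (qpoch _ _ _) (qpoch _ _ _) (qpoch _ _ _) => V1 V2 W.
  move: (1 - x ^+ 2 * q ^+ 2) (1 - x ^+ 2 * q ^+ (2 * _)) => w1 w2.
  move: (1 + a * x * q) (1 + a * x * q ^+ _) => s al.
  move: (1 + b * x * q) (1 + b * x * q ^+ _) => t be SV SA SB.
  move: (q ^+ _) (q ^+ _) (x ^+ _) (_ ^+ n) => q1 q2 x1 x2.
  transitivity (x2 * (x1 * q1) * q2 * (B1 * A1) / V1 * (W * w1)
                * (al / A') * (be / B')); first by ring.
  by rewrite SV SA SB; ring.
have Us : (1 + a * x * q) * (1 + b * x * q) * (1 - x * q) \is a GRing.unit.
  rewrite !unitrM (one_plus_unit (a * x) 0) (one_plus_unit (b * x) 0).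
  exact: (one_minus_unit x 0).
apply: (unit_mulI Us); have := prefactor_shift x; move: E.
have -> : 1 - x ^+ 2 * q ^+ 2 = (1 - x * q) * (1 + x * q) by ring.
move: (prefactor _) (prefactor _) (core _ _) (core _ _) => P P' c c'.
move: ((1 + a * x * q) * _) (_ * (1 + b * x * q ^+ _)) => st albe.
move: (1 - a * _ * _ * _) (1 - _ * q ^+ _) (1 - x * q) => w v u.
move: (q ^+ _) => q1 E1 E2.
rewrite [X in X = _](_ : _
  = (c' * albe * (u * (1 + x * q))) * (P' * st)); last by ring.
by rewrite E1 E2; ring.
Qed.

(** The factors with q^(n+2) are the last ones in the denominators of [core x n.+1] and of
    [core (x * q) n]. Dividing by them makes these two and [core x n] multiples of one quantity, up
    to explicit factors. *)
Definition core_lift x n : fps R :=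
  core x n / ((1 + a * x * q ^+ n.+2) * (1 + b * x * q ^+ n.+2)).

Lemma core_liftK x n :
  core_lift x n * ((1 + a * x * q ^+ n.+2) * (1 + b * x * q ^+ n.+2)) = core x n.
Proof. by rewrite divrK // unitrM !one_plus_unit. Qed.

Lemma core_lift_next x n :
  core_lift x n * (1 - x ^+ 2 * q ^+ (2 * n.+1)) * ((a + q ^+ n) * (b + q ^+ n))
    * (x ^+ (k - 1) * q ^+ ((k - 1) * (2 * n + 1)))
  = - (core x n.+1 * (1 - q ^+ (2 * n.+1))).
Proof.
have Us : (1 + a * x * q ^+ n.+2) * (1 + b * x * q ^+ n.+2) \is a GRing.unit.
  by rewrite unitrM !one_plus_unit.
apply: (unit_mulI Us); have := core_next x n; have := core_liftK x n.
move: (core_lift _ _) (core _ n) (core _ n.+1) => e c c'.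
move: (x ^+ (k - 1)) (q ^+ ((k - 1) * _)) => x1 q1.
move: (1 - x ^+ 2 * _) (1 - q ^+ _) ((a + _) * _) => v w r.
move: (_ * (1 + _)) => s eE cE.
have -> : - (c' * w) * s = - (c' * s * w) by ring.
by rewrite cE -eE; ring.
Qed.

End CoreSequence.

(** * The q-difference equations *)

Section QDifference.
Variables (R : comUnitRingType) (k : nat) (a b : fps R).
Hypotheses (k_ge2 : (2 <= k)%N).
Hypotheses (Ua : a \is a GRing.unit) (Ub : b \is a GRing.unit).
Implicit Type x : fps R.

Notation q := (@fpsq R).
Notation prefactor := (prefactor a b).
Notation core := (core k a b).
Notation core_lift := (core_lift k a b).

(** By [term_core] at xq and [prefactor_core_shift]: in the first half the factors with q^(n+2)
    restore [core], in the second half [core_lift] remains. *)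
Lemma term_shift x n j : (1 <= j <= k)%N ->
  prefactor (x * q) * (1 + x * q) * Rt_term k j a b (x * q) n
  = prefactor x * (1 - a * b * x * q) * (1 - x ^+ 2 * q ^+ (2 * n.+1))
    * (core x n * q ^+ (n + (2 * k - 1 - j) * n)
       - core_lift x n * x ^+ j * q ^+ ((k - 1) * (2 * n) + j * n.+2)
           * ((a + q ^+ n) * (b + q ^+ n))).
Proof.
move=> jk; rewrite (term_core Ua Ub) // -[core x n]core_liftK.
have := prefactor_core_shift k a b x n; rewrite -[core x n]core_liftK.
have Us : (1 + a * x * q ^+ n.+2) * (1 + b * x * q ^+ n.+2) \is a GRing.unit.
  by rewrite unitrM !one_plus_unit.
have cE c : 1 + c * (x * q) * q ^+ n.+1 = 1 + c * x * q ^+ n.+2.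
  by rewrite !mulrA -mulrA -exprS.
rewrite !cE; move: Us; move: ((1 + _) * (1 + _ * q ^+ _)) => s Us.
(* Splits off (k - 1) n, the exponent of q in [prefactor_core_shift]. *)
have -> : (n + (2 * k - 1 - j) * n = (k - 1) * n + (n + (k - j) * n))%N.
  have -> : (2 * k - 1 - j = (k - 1) + (k - j))%N by lia.
  by rewrite mulnDl addnCA.
have -> : ((k - 1) * (2 * n) + j * n.+2
           = (k - 1) * n + (j + ((k - 1) * n + j * n.+1)))%N.
  rewrite [(j * n.+2)%N]mulnS mul2n -addnn mulnDr -addnA.
  by congr (_ + _)%N; rewrite addnCA.
move: ((k - 1) * n + j * n.+1)%N (n + (k - j) * n)%N => E1 E2.
rewrite exprMn (exprD q ((k - 1) * n)) (exprD q ((k - 1) * n)) (exprD q j).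
move: (core_lift _ _) (core _ _) (prefactor _) (prefactor _) => e c P' P.
move: (1 - a * _ * _ * _) (1 - x ^+ 2 * _) (1 + x * q) (_ * (b + _)) => w v d r.
move: (q ^+ E1) (q ^+ E2) (q ^+ j) (x ^+ j) (q ^+ _) => q1 q2 q3 x1 q4.
move=> H; have H1 : P * c * d = P' * e * w * q4 * v.
  by apply: (unit_mulI Us); rewrite H; ring.
transitivity (P * c * d * (q2 * s - x1 * q3 * q1 * r)); first by ring.
by rewrite H1; ring.
Qed.

Lemma Rt_partial x i M : (1 <= i <= k)%N ->
  eqmodq M (Rt k i a b x)
           (prefactor x * \sum_(n < M) Rt_term k i a b x n).
Proof.
move=> ik; apply: eqmodqM => //; apply: fps_lim_modq => n.
rewrite big_ord_recr /= addrAC subrr add0r (term_core Ua Ub) //.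
(* A factor q^n splits off since k >= 2, so the n-th summand vanishes modulo q^n. *)
have -> : ((k - 1) * n + i * n.+1 = n + ((k - 2) * n + i * n.+1))%N.
  by rewrite addnA -mulSn; congr (_ * _ + _)%N; lia.
rewrite (exprD q n) (exprD q n).
move: (q ^+ n) (q ^+ ((k - i) * n)) (q ^+ (_ + i * _)) => Q Q1 Q2.
exists (core x n * (Q1 * ((1 + a * x * q ^+ n.+1) * (1 + b * x * q ^+ n.+1))
   - x ^+ i * Q2 * ((a + Q) * (b + Q)))).
by move: (core _ _) (_ * (1 + _)) (x ^+ i) => c s x1; ring.
Qed.

(** The two sums differ by h 0 - h M = - h M, which vanishes modulo q^M. *)
Lemma telescope_modq (u v h : nat -> fps R) M :
  (forall n, u n = v n + (h n - h n.+1)) -> h 0%N = 0 ->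
  (forall n, exists g, h n = q ^+ n * g) ->
  eqmodq M (\sum_(n < M) u n) (\sum_(n < M) v n).
Proof.
move=> uv h0 hq.
have -> : \sum_(n < M) u n = \sum_(n < M) v n - h M.
  under eq_bigr do rewrite uv.
  rewrite big_split /=; congr (_ + _).
  rewrite -(big_mkord xpredT (fun n => h n - h n.+1)) /=.
  under eq_bigr do rewrite -opprB.
  by rewrite sumrN telescope_sumr // h0 subr0.
rewrite -[X in eqmodq _ _ X]addr0; apply: eqmodqD => //.
by have [g ->] := hq M; rewrite -mulrN; apply: eqmodq_qX.
Qed.

Lemma one_plus_xq_unit x : 1 + x * q \is a GRing.unit.
Proof. exact: (one_plus_unit x 0). Qed.

(* The factor [1 + x * q] clears the denominator in [term_shift]. *)
Definition rt_summand x i y n :=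
  prefactor y * (1 + x * q) * Rt_term k i a b y n.

Lemma rt_summand_partial x i y M : (1 <= i <= k)%N ->
  eqmodq M ((1 + x * q) * Rt k i a b y) (\sum_(n < M) rt_summand x i y n).
Proof.
move=> ik; rewrite -mulr_sumr [prefactor y * _]mulrC -(mulrA (1 + _)).
by apply: eqmodqM => //; apply: Rt_partial.
Qed.

Lemma q_double n : q ^+ (2 * n) = q ^+ n * q ^+ n.
Proof. by rewrite mul2n -addnn exprD. Qed.

Lemma q_doubleS n : q ^+ (2 * n.+1) = q * q * (q ^+ n * q ^+ n).
Proof. by rewrite q_double exprS; move: (q ^+ n) => Q; ring. Qed.

Lemma q_kn n : q ^+ (k * n) = q ^+ n * q ^+ ((k - 1) * n).
Proof. by rewrite -exprD -mulSn; congr (_ ^+ (_ * _)); lia. Qed.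

Lemma core_lift_next_eq x n :
  core x n.+1 * (1 - q * q * (q ^+ n * q ^+ n))
  = - (core_lift x n * (1 - x ^+ 2 * (q * q * (q ^+ n * q ^+ n)))
       * ((a + q ^+ n) * (b + q ^+ n))
       * (x ^+ (k - 1) * q ^+ ((k - 1) * (2 * n + 1)))).
Proof. by rewrite -!q_doubleS core_lift_next // opprK. Qed.

(** For i = 1 the terms in a + b of the bracket cancel, and the rest factors as (1 - abxq)(1 - x
    q^(2n+1)). *)
Lemma rt_summand_1 x n : rt_summand x 1 x n =
  prefactor x * (1 + x * q) * (1 - a * b * x * q) * core x n
    * (q ^+ n * q ^+ ((k - 1) * n)) * (1 - x * q * (q ^+ n * q ^+ n)).
Proof.
rewrite /rt_summand (term_core Ua Ub); last by lia.
rewrite mul1n expr1 !(exprD q) exprS.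
by move: (core _ _) (q ^+ n) (q ^+ _) (prefactor _) => *; ring.
Qed.

(** The recurrence turns the second half of [term_shift] into a multiple of the next term
    [core x n.+1], ready to telescope. *)
Lemma rt_summand_k_shift x n : rt_summand x k (x * q) n =
  prefactor x * (1 - a * b * x * q)
  * (core x n * (1 - x ^+ 2 * q ^+ (2 * n.+1)) * (q ^+ n * q ^+ ((k - 1) * n))
     + core x n.+1 * (1 - q ^+ (2 * n.+1)) * x * q ^+ (k * n.+1).+1).
Proof.
rewrite /rt_summand term_shift; last by lia.
have -> : (2 * k - 1 - k = k - 1)%N by lia.
have kE : (k = (k - 1).+1)%N by lia.
have -> : ((k - 1) * (2 * n) + k * n.+2
    = (k - 1) * (2 * n + 1) + (k * n.+1).+1)%N.
  by move: kE; move: (k - 1)%N => m ->; lia.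
have -> : x ^+ k = x * x ^+ (k - 1) by rewrite -exprS -kE.
rewrite q_doubleS core_lift_next_eq !(exprD q).
move: (core _ _) (core_lift _ _) (prefactor _) => c e P.
by move: (x ^+ _) (q ^+ n) (q ^+ _.+1) (q ^+ (_ * n)) (q ^+ _) => *; ring.
Qed.

Lemma Rt_one x : Rt k 1 a b x = Rt k k a b (x * q).
Proof.
have k1 : (1 <= 1 <= k)%N by lia.
have kk : (1 <= k <= k)%N by lia.
apply: (unit_mulI (one_plus_xq_unit x)).
rewrite [LHS]mulrC [RHS]mulrC.
apply: eqmodq_eq => M.
apply: eqmodq_trans (@rt_summand_partial x 1 x M k1) _.
apply: eqmodq_trans _ (eqmodq_sym (@rt_summand_partial x k (x * q) M kk)).
(* [h n.+1] is the part of the n-th shifted summand that carries [core x n.+1]; the factor 1 -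
   q^(2n) makes [h 0] vanish. *)
pose h n := prefactor x * (1 - a * b * x * q) * (core x n * (1 - q ^+ (2 * n))
  * x * q ^+ (k * n).+1).
apply: (@telescope_modq _ (rt_summand x k (x * q)) h) => [n||n]; rewrite /h.
- rewrite rt_summand_1 rt_summand_k_shift (exprS q (k * n)) q_kn q_doubleS.
  rewrite q_double; move: (q ^+ n) (q ^+ (_ * n)) (q ^+ (k * _).+1) => Q K H.
  by move: (core _ _) (core _ _) (prefactor _) => *; ring.
- by rewrite muln0 expr0 subrr !(mulr0, mul0r).
rewrite exprS q_kn; move: (q ^+ n) (q ^+ ((k - 1) * n)) (1 - q ^+ _) => Q Q1 d.
move: (core _ _) (prefactor _) => c P.
by exists (P * (1 - a * b * x * q) * c * d * x * q * Q1); ring.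
Qed.
Lemma rt_summand_2 x n : rt_summand x 2 x n =
  prefactor x * (1 + x * q) * core x n * q ^+ ((k - 1) * n)
    * ((1 + a * x * q ^+ n.+1) * (1 + b * x * q ^+ n.+1)
       - x ^+ 2 * q ^+ (2 * n.+1) * ((a + q ^+ n) * (b + q ^+ n))).
Proof.
rewrite /rt_summand (term_core Ua Ub) //; rewrite (exprD q ((k - 1) * n)).
have -> : (n + (k - 2) * n = (k - 1) * n)%N.
  by rewrite -mulSn; congr (_ * _)%N; lia.
move: (q ^+ (2 * _)) (q ^+ (_ * n)) (_ * (1 + _ * q ^+ _)) => *.
by move: (core _ _) (prefactor _) (_ * (b + _)) => *; ring.
Qed.

Lemma rt_summand_pred_shift x n : rt_summand x (k - 1) (x * q) n =
  prefactor x * (1 - a * b * x * q)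
  * (core x n * (1 - x ^+ 2 * q ^+ (2 * n.+1))
       * (q ^+ (2 * n) * q ^+ ((k - 1) * n))
     + core x n.+1 * (1 - q ^+ (2 * n.+1)) * q ^+ ((k - 1) * n.+1)).
Proof.
rewrite /rt_summand term_shift; last by lia.
have kE : (k = (k - 1).+1)%N by lia.
have -> : (n + (2 * k - 1 - (k - 1)) * n = 2 * n + (k - 1) * n)%N.
  have -> : (2 * k - 1 - (k - 1) = (k - 1).+1)%N by lia.
  by rewrite mulSn addnA addnn mul2n.
have -> : ((k - 1) * (2 * n) + (k - 1) * n.+2
    = (k - 1) * (2 * n + 1) + (k - 1) * n.+1)%N.
  by rewrite -!mulnDr; congr (_ * _)%N; lia.
rewrite q_doubleS core_lift_next_eq (exprD q (2 * n)) q_double !(exprD q).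
move: (core _ _) (core_lift _ _) (prefactor _) => c e P.
move: (q ^+ n) (q ^+ (_ * n)) (q ^+ (_ * n.+1)) => Q K G.
by move: (x ^+ (k - 1)) (q ^+ _) => *; ring.
Qed.

Lemma Rt_two x : (1 - a * b * x * q) * Rt k 2 a b x =
  (1 + x * q) * Rt k (k - 1) a b (x * q)
  + (a + b) * x * q * Rt k k a b (x * q).
Proof.
have k2 : (1 <= 2 <= k)%N by lia.
have kk : (1 <= k <= k)%N by lia.
have kp : (1 <= k - 1 <= k)%N by lia.
apply: (unit_mulI (one_plus_xq_unit x)).
have -> : (1 - a * b * x * q) * Rt k 2 a b x * (1 + x * q)
  = (1 - a * b * x * q) * ((1 + x * q) * Rt k 2 a b x).
  by move: (Rt _ _ _ _ _) => *; ring.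
have -> : ((1 + x * q) * Rt k (k - 1) a b (x * q) +
     (a + b) * x * q * Rt k k a b (x * q)) * (1 + x * q)
  = (1 + x * q) * ((1 + x * q) * Rt k (k - 1) a b (x * q))
    + (a + b) * x * q * ((1 + x * q) * Rt k k a b (x * q)).
  by move: (Rt _ _ _ _ _) (Rt _ _ _ _ _) => *; ring.
apply: eqmodq_eq => M; apply: eqmodq_trans.
  apply: eqmodqM; first exact: eqmodq_refl.
  exact: (@rt_summand_partial x 2 x M k2).
apply: eqmodq_sym; apply: eqmodq_trans.
  by apply: eqmodqD; (apply: eqmodqM; first exact: eqmodq_refl);
     apply: rt_summand_partial.
apply: eqmodq_sym; rewrite !mulr_sumr -big_split /=.
(* [h n.+1] gathers the parts with [core x n.+1] of both shifted summands, with their coefficients 1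
   + xq and (a + b) xq. *)
pose h n := prefactor x * (1 - a * b * x * q) * (core x n * (1 - q ^+ (2 * n))
  * ((1 + x * q) * q ^+ ((k - 1) * n) + (a + b) * x * q * x * q ^+ (k * n).+1)).
apply: (@telescope_modq (fun n => (1 - a * b * x * q) * rt_summand x 2 x n)
  (fun n => (1 + x * q) * rt_summand x (k - 1) (x * q) n
            + (a + b) * x * q * rt_summand x k (x * q) n) h) => [n||n]; rewrite /h.
- rewrite rt_summand_2 rt_summand_k_shift rt_summand_pred_shift.
  rewrite (exprS q (k * n)) (exprS q n) q_kn q_doubleS q_double.
  move: (q ^+ (k * _).+1) (q ^+ (_ * n.+1)) (q ^+ n) (q ^+ (_ * n)) => H G Q K.
  by move: (core _ _) (core _ _) (prefactor _) => *; ring.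
- by rewrite muln0 expr0 subrr !(mulr0, mul0r).
have -> : q ^+ ((k - 1) * n) = q ^+ n * q ^+ ((k - 2) * n).
  by rewrite -exprD -mulSn; congr (_ ^+ (_ * _)); lia.
rewrite (exprS q (k * n)) q_kn.
move: (q ^+ n) (q ^+ ((k - 1) * n)) (q ^+ ((k - 2) * n)) (1 - q ^+ _) => Q K L d.
move: (core _ _) (prefactor _) => c P.
exists (P * (1 - a * b * x * q) * (c * d *
   ((1 + x * q) * L + (a + b) * x * q * x * (q * K)))).
by ring.
Qed.
(** From i = m + 3 to i = m + 1 the first half gains q^(2n) and the second loses x^2 q^(2n+2). The
    differences produce the two factors of [core_next], the first of them at index n - 1. *)
Lemma rt_summand_diff x m n : (m.+3 <= k)%N ->
  rt_summand x m.+3 x n - rt_summand x m.+1 x n =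
  prefactor x * (1 + x * q) * core x n
    * (q ^+ (n + (k - m.+3) * n) * (1 - q ^+ (2 * n))
         * ((1 + a * x * q ^+ n.+1) * (1 + b * x * q ^+ n.+1))
       + x ^+ m.+1 * q ^+ ((k - 1) * n + m.+1 * n.+1)
         * (1 - x ^+ 2 * q ^+ (2 * n.+1)) * ((a + q ^+ n) * (b + q ^+ n))).
Proof.
move=> mk; rewrite /rt_summand !(term_core Ua Ub); [|lia..].
have -> : (n + (k - m.+1) * n = (n + (k - m.+3) * n) + 2 * n)%N.
  by rewrite -addnA -mulnDl; congr (_ + _ * _)%N; lia.
have -> : ((k - 1) * n + m.+3 * n.+1 = ((k - 1) * n + m.+1 * n.+1) + 2 * n.+1)%N.
  by rewrite -addnA -mulnDl; congr (_ + _ * _)%N; lia.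
have -> : x ^+ m.+3 = x ^+ 2 * x ^+ m.+1 by rewrite -exprD.
rewrite (exprD q _ (2 * n)) (exprD q _ (2 * n.+1)).
move: (q ^+ (2 * _)) (q ^+ (2 * _)) (q ^+ (_ + _)) (q ^+ (_ + _)) => q1 q2 q3 q4.
move: (_ * (1 + b * _ * _)) (_ * (b + _)) (x ^+ 2) (x ^+ _) => s r x2 x1.
by move: (core _ _) (prefactor _) => *; ring.
Qed.

(** The weights 1, a + b, ab make q^(2n) + (a + b) q^n + ab = (a + q^n)(b + q^n) appear, while 1 +
    (a + b) x q^(n+2) + ab x^2 q^(2n+4) turns [core_lift] back into [core]. *)
Lemma rt_summand_sum_shift x j n : (1 <= j)%N -> (j.+2 <= k)%N ->
  rt_summand x j (x * q) n + (a + b) * rt_summand x j.+1 (x * q) n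
    + a * b * rt_summand x j.+2 (x * q) n =
  prefactor x * (1 - a * b * x * q) * (1 - x ^+ 2 * q ^+ (2 * n.+1))
    * core x n * ((a + q ^+ n) * (b + q ^+ n))
    * (q ^+ ((2 * k - 2 - j) * n)
       - x ^+ j * q ^+ ((k - 1) * (2 * n) + j * n.+2)).
Proof.
move=> j1 jk; rewrite /rt_summand (@term_shift x n j)
  ?(@term_shift x n j.+1) ?(@term_shift x n j.+2); [|lia..].
have -> : (n + (2 * k - 1 - j) * n = (2 * n) + (2 * k - 2 - j) * n)%N.
  have -> : (2 * k - 1 - j = (2 * k - 2 - j).+1)%N by lia.
  by rewrite mulSn addnA addnn -mul2n.
have -> : (n + (2 * k - 1 - j.+1) * n = n + (2 * k - 2 - j) * n)%N.
  by have -> : (2 * k - 1 - j.+1 = 2 * k - 2 - j)%N by lia.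
have -> : (n + (2 * k - 1 - j.+2) * n = (2 * k - 2 - j) * n)%N.
  by rewrite -mulSn; have -> : (2 * k - 1 - j.+2).+1 = (2 * k - 2 - j)%N by lia.
have -> : ((k - 1) * (2 * n) + j.+1 * n.+2
    = n.+2 + ((k - 1) * (2 * n) + j * n.+2))%N by rewrite (mulSn j) addnCA.
have -> : ((k - 1) * (2 * n) + j.+2 * n.+2
    = n.+2 + (n.+2 + ((k - 1) * (2 * n) + j * n.+2)))%N.
  by rewrite (mulSn j.+1) (mulSn j) !(addnCA _ n.+2).
rewrite (exprD q (2 * n)) (q_double n) (exprD q n) !(exprD q n.+2).
rewrite !(exprS q n.+1) !(exprS q n) (exprS x j.+1) !(exprS x j).
have := core_liftK k a b x n; rewrite !(exprS q n.+1) !(exprS q n) => <-.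
move: (q ^+ (_ * n)) (q ^+ (_ + _)) (x ^+ j) => q1 q2 x1.
move: (1 - x ^+ 2 * (q ^+ _)) (q ^+ n) (core_lift _ _) (prefactor _) => v Q e P.
by ring.
Qed.

Lemma Rt_step x m : (m.+3 <= k)%N ->
  (1 - a * b * x * q) * (Rt k m.+3 a b x - Rt k m.+1 a b x) =
  (x * q) ^+ m.+1 * (1 + x * q) *
    (Rt k (k - m.+2) a b (x * q) + (a + b) * Rt k (k - m.+1) a b (x * q)
     + a * b * Rt k (k - m) a b (x * q)).
Proof.
move=> mk; have [j [j1 kE]] : exists j, (1 <= j)%N /\ k = (j + m.+2)%N.
  by exists (k - m.+2)%N; lia.
have -> : (k - m.+2 = j)%N by lia.
have -> : (k - m.+1 = j.+1)%N by lia.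
have -> : (k - m = j.+2)%N by lia.
apply: (unit_mulI (one_plus_xq_unit x)).
have -> : (1 - a * b * x * q) * (Rt k m.+3 a b x - Rt k m.+1 a b x) * (1 + x * q)
  = (1 - a * b * x * q) * ((1 + x * q) * Rt k m.+3 a b x
                           - (1 + x * q) * Rt k m.+1 a b x).
  by move: (Rt _ _ _ _ _) (Rt _ _ _ _ _) => *; ring.
have -> : (x * q) ^+ m.+1 * (1 + x * q) *
    (Rt k j a b (x * q) + (a + b) * Rt k j.+1 a b (x * q)
     + a * b * Rt k j.+2 a b (x * q)) * (1 + x * q)
  = (x * q) ^+ m.+1 * (1 + x * q) *
    ((1 + x * q) * Rt k j a b (x * q)
     + (a + b) * ((1 + x * q) * Rt k j.+1 a b (x * q))
     + a * b * ((1 + x * q) * Rt k j.+2 a b (x * q))).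
  by move: (_ ^+ _) (Rt _ _ _ _ _) (Rt _ _ _ _ _) (Rt _ _ _ _ _) => *; ring.
apply: eqmodq_eq => M; apply: eqmodq_trans.
  apply: eqmodqM; first exact: eqmodq_refl.
  by apply: eqmodqD; [|apply: eqmodqN]; apply: rt_summand_partial; lia.
apply: eqmodq_sym; apply: eqmodq_trans.
  apply: eqmodqM; first exact: eqmodq_refl.
  apply: eqmodqD; [apply: eqmodqD|].
  - by apply: rt_summand_partial; lia.
  - by apply: eqmodqM; [exact: eqmodq_refl|apply: rt_summand_partial; lia].
  - by apply: eqmodqM; [exact: eqmodq_refl|apply: rt_summand_partial; lia].
apply: eqmodq_sym; rewrite -sumrN !mulr_sumr -!big_split /= !mulr_sumr.
(* [h n] is the first half of [rt_summand_diff] times 1 - abxq. By [core_next], [h n.+1] is the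
   second half of [rt_summand_sum_shift], sign included, times its coefficient. *)
pose h n := prefactor x * (1 - a * b * x * q) * (1 + x * q)
  * (core x n * ((1 + a * x * q ^+ n.+1) * (1 + b * x * q ^+ n.+1))
     * (1 - q ^+ (2 * n)) * q ^+ (n + (k - m.+3) * n)).
apply: (@telescope_modq
  (fun n => (1 - a * b * x * q) * (rt_summand x m.+3 x n - rt_summand x m.+1 x n))
  (fun n => (x * q) ^+ m.+1 * (1 + x * q) * (rt_summand x j (x * q) n
     + (a + b) * rt_summand x j.+1 (x * q) n
     + a * b * rt_summand x j.+2 (x * q) n)) h) => [n||n]; rewrite /h.
- rewrite rt_summand_diff // rt_summand_sum_shift //; last by lia.
  rewrite (core_next k Ua Ub).
  have -> : ((2 * k - 2 - j) * n = (k - 1) * n + m.+1 * n)%N.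
    by rewrite -mulnDl; congr (_ * _)%N; lia.
  have -> : ((k - 1) * n + m.+1 * n.+1 = ((k - 1) * n + m.+1 * n) + m.+1)%N.
    by rewrite mulnSr addnA.
  have -> : x ^+ (k - 1) = x ^+ m.+1 * x ^+ j.
    by rewrite -exprD; congr (_ ^+ _); lia.
  have E : q ^+ ((k - 1) * (2 * n + 1)) * q ^+ (n.+1 + (k - m.+3) * n.+1)
      = q ^+ m.+1 * q ^+ ((k - 1) * (2 * n) + j * n.+2).
    rewrite -!exprD; congr (_ ^+ _).
    have -> : (k - m.+3 = j - 1)%N by lia.
    have -> : (k - 1 = j + m.+1)%N by lia.
    case: j j1 {kE} => // j _; rewrite subn1 /=.
    by rewrite mulnDr muln1 mulnSr [(j.+1 * n.+2)%N]mulnSr mulSn; lia.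
  move: E; rewrite exprMn (exprD q _ m.+1).
  move: (q ^+ ((k - 1) * (2 * n + 1))) (q ^+ (_ * (2 * _) + _)) => Z Y.
  move: (q ^+ (n.+1 + (k - _) * _)) (q ^+ (_ + m.+1 * _)) => L B.
  move: (q ^+ (n + _)) => B'.
  move: (1 - x ^+ 2 * _) (1 - q ^+ _) (q ^+ m.+1) (x ^+ m.+1) (x ^+ j).
  move=> v w qm xm xj E.
  move: (core _ _) (prefactor _) ((a + _) * _) ((1 + _ * q ^+ _) * _).
  by move=> c P r s; ring: E.
- by rewrite muln0 expr0 subrr !(mulr0, mul0r).
rewrite (exprD q n); move: (q ^+ n) (q ^+ ((k - _) * _)) => Q L.
move: (core _ _) (prefactor _) ((1 + _ * q ^+ _) * _) (1 - q ^+ _) => c P s d.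
exists (P * (1 - a * b * x * q) * (1 + x * q) * (c * s * d * L)).
by ring.
Qed.
End QDifference.

(** * The parts of size 1 *)

(* [((f, o), (g, p))] records, for one part size, the multiplicities [f] and [g]
   of the non-overlined part in lambda and mu, and whether the overlined part
   occurs in lambda ([o]) and in mu ([p]). *)
Definition part_data := ((nat * bool) * (nat * bool))%type.

Implicit Type h : part_data.

Definition dover h : nat := (h.1.2 + h.2.2)%N.
Definition dsize h : nat := (h.1.1 + h.1.2 + (h.2.1 + h.2.2))%N.
Definition dval h : nat :=
  (h.1.1 + h.1.2 + h.2.2
   + [&& 0 < h.2.1, h.2.2 == 0 :> nat, h.1.1 == 0 & h.1.2 == 0 :> nat])%N.

(* If the part size 1 has data [h], then removing it and decreasing all other
   parts by 1 turns the conditions for [(k, i)] into those for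
   [(k, next_index k i h)]. *)
Definition shifted_index k i f d : nat :=
  if odd (f + d + i) then (k - f)%N else (k - f).-1.
Definition next_index k i h : nat := shifted_index k i h.1.1 (dover h).

(** The conditions put no bound on the non-overlined multiplicity in mu, so it is cut off at [B] to
    keep the list finite. *)
Definition heads k B : seq part_data :=
  [seq (fo, gp) | fo <- [seq (f, o) | f <- iota 0 k, o <- [:: false; true]],
                  gp <- [seq (g, p) | g <- iota 0 B.+1, p <- [:: false; true]]].

Section HeadSum.
Variables (R : comUnitRingType) (k : nat) (a b : fps R).
Hypotheses (k_ge2 : (2 <= k)%N).
Hypotheses (Ua : a \is a GRing.unit) (Ub : b \is a GRing.unit).
Implicit Type x : fps R.

Notation q := (@fpsq R).

Definition head_weight (y : fps R) h : fps R :=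
  a ^+ (h.1.2 + h.2.1) * b ^+ (h.2.1 + h.2.2) * y ^+ dsize h.

Lemma sum_heads B (F : part_data -> fps R) :
  \sum_(h <- heads k B) F h =
  \sum_(f < k) \sum_(g < B.+1) (F ((nat_of_ord f, false), (nat_of_ord g, false))
    + F ((nat_of_ord f, false), (nat_of_ord g, true))
    + F ((nat_of_ord f, true), (nat_of_ord g, false))
    + F ((nat_of_ord f, true), (nat_of_ord g, true))).
Proof.
have iotaE n : iota 0 n = index_iota 0 n by rewrite /index_iota subn0.
rewrite /heads; move: B.+1 => {}B.
rewrite !big_allpairs_dep /= !iotaE big_mkord; apply: eq_bigr => f _.
rewrite !big_cons !big_nil /= addr0 !big_flatten !big_map !big_mkord -big_split /=.
by apply: eq_bigr => g _; rewrite !big_cons !big_nil !addr0 !addrA.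
Qed.

(** For i >= 2, the contribution of the heads with d overlined parts, stripped of a, b and of the
    non-overlined parts of mu. *)
Definition head_sum_part x i d : fps R :=
  \sum_(f < i - d) (x * q) ^+ (f + d) * Rt k (shifted_index k i f d) a b (x * q).

(** An overlined part weighs a in lambda and b in mu, so 1, a + b, ab account for zero, one and two
    of them. *)
Definition head_sum x i : fps R :=
  head_sum_part x i 0 + (a + b) * head_sum_part x i 1
  + a * b * head_sum_part x i 2.

(** The parity of f + d + i, hence every old term, is unchanged. The two new values f = m + 1 - d
    and f = m + 2 - d have the same shifted index, whence the factor 1 + xq. *)
Lemma head_sum_part_step x m d : (d <= m.+1)%N ->
  head_sum_part x m.+3 d = head_sum_part x m.+1 d
  + (x * q) ^+ m.+1 * (1 + x * q) * Rt k (k - (m.+2 - d)) a b (x * q).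
Proof.
move=> dm; rewrite /head_sum_part.
have [e eE] : exists e, (m.+1 = e + d)%N by exists (m.+1 - d)%N; lia.
have -> : (m.+3 - d = e.+2)%N by lia.
have -> : (m.+1 - d = e)%N by lia.
rewrite big_ord_recr.
rewrite big_ord_recr.
rewrite /= -[LHS]addrA.
apply: congr2.
  by apply: eq_bigr => f _; rewrite /shifted_index !addnS /= negbK.
rewrite /shifted_index.
have -> : (e + d + m.+3 = m.+2.*2)%N by lia.
have -> : (e.+1 + d + m.+3 = m.+2.*2.+1)%N by lia.
rewrite oddS odd_double /=.
have -> : (k - (m.+2 - d) = (k - e).-1)%N by lia.
have -> : (k - e.+1 = (k - e).-1)%N by lia.
rewrite addSn -eE (exprS _ m.+1).
by move: (Rt _ _ _ _ _) (_ ^+ m.+1) => *; ring.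
Qed.

Lemma head_sum_part_empty x i d : (i <= d)%N -> head_sum_part x i d = 0.
Proof. by move=> id; rewrite /head_sum_part (eqP id) big_ord0. Qed.

Lemma head_sum_part_one x d : odd (d + d.+1) ->
  head_sum_part x d.+1 d = (x * q) ^+ d * Rt k k a b (x * q).
Proof.
move=> dd; rewrite /head_sum_part subSnn big_ord1 /shifted_index.
by rewrite !add0n dd subn0.
Qed.

Lemma head_sum_part_two_zero x :
  head_sum_part x 2 0 = (1 + x * q) * Rt k (k - 1) a b (x * q).
Proof.
rewrite /head_sum_part subn0 big_ord_recr /= big_ord1 /shifted_index.
rewrite !addn0 /= subn0 subn1 expr0 expr1.
by move: (Rt _ _ _ _ _) => *; ring.
Qed.

(* The correction for [i = 1] removes the unattached 1's: they have valuation 1,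
   but [head_sum] does not tell them from the empty configuration. *)
Lemma Rt_head_sum x i : (1 <= i <= k)%N ->
  (1 - a * b * x * q) * Rt k i a b x =
  head_sum x i - (if i == 1%N then a * b * (x * q) * Rt k 1 a b x else 0).
Proof.
elim/ltn_ind: i => -[//|[_|[_|m IHm]]] ik.
- rewrite /head_sum (@head_sum_part_one x 0) // !head_sum_part_empty // expr0.
  by rewrite (Rt_one k_ge2 Ua Ub) /=; move: (Rt _ _ _ _ _) => *; ring.
- rewrite /head_sum head_sum_part_two_zero (@head_sum_part_one x 1) //.
  rewrite head_sum_part_empty // (Rt_two k_ge2 Ua Ub) expr1 /=.
  by move: (Rt _ _ _ _ _) (Rt _ _ _ _ _) => *; ring.
have S1 : _ = _ := Rt_step k_ge2 Ua Ub x (m := m) ltac:(lia).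
have S2 : _ = _ := IHm m.+1 ltac:(lia) ltac:(lia).
have -> : (1 - a * b * x * q) * Rt k m.+3 a b x
  = (1 - a * b * x * q) * (Rt k m.+3 a b x - Rt k m.+1 a b x)
    + (1 - a * b * x * q) * Rt k m.+1 a b x.
  by move: (Rt _ _ _ _ _) (Rt _ _ _ _ _) => *; ring.
rewrite {}S1 {}S2 /head_sum (@head_sum_part_step x m 0) // (@head_sum_part_step x m 1) //.
rewrite subn0 subn1 /=.
case: m {IHm} ik => [|m] ik.
  (* By [Rt_one] the correction of i = 1 is ab xq R_k(xq). It removes one of the two terms of xq (1
     + xq), since [head_sum_part x 3 2] has only the term (xq)^2. *)
  rewrite (@head_sum_part_one x 2) // (@head_sum_part_empty x 1 2) //.
  rewrite (Rt_one k_ge2 Ua Ub) eqxx subn0 expr1.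
  move: (head_sum_part _ _ _) (head_sum_part _ _ _) => *.
  by move: (Rt _ _ _ _ _) (Rt _ _ _ _ _) (Rt _ _ _ _ _) => *; ring.
rewrite (@head_sum_part_step x m.+1 2) // subn2 /=.
move: (head_sum_part _ _ _) (head_sum_part _ _ _) (head_sum_part _ _ _) => *.
by move: (Rt _ _ _ _ _) (Rt _ _ _ _ _) (Rt _ _ _ _ _) (_ ^+ _) => *; ring.
Qed.

End HeadSum.

(** * Configurations and their generating function *)

Implicit Types (c : seq part_data).

Fixpoint configs k B M : seq (seq part_data) :=
  if M is M'.+1 then [seq h :: c | h <- heads k B, c <- configs k B M']
  else [:: [::]].

(* The [j]-th entry of a configuration describes the parts of size [j + 1]. *)
Fixpoint allowed k i c : bool :=
  if c is h :: c' then (dval h < i)%N && allowed k (next_index k i h) c'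
  else true.

Lemma mem_heads k B h : (h \in heads k B) = (h.1.1 < k)%N && (h.2.1 <= B)%N.
Proof.
case: h => [[f o] [g p]]; have mem_b (b : bool) : b \in [:: false; true].
  by case: b.
apply/allpairsP/andP => [[[u v] [Hu Hv [uE vE]]]|[fk gB]].
  case/allpairsP: Hu uE => -[f1 o1] [f1k _ /= ->] [-> _].
  case/allpairsP: Hv vE => -[g1 p1] [g1B _ /= ->] [-> _].
  by move: f1k g1B; rewrite !mem_iota /= => f1k g1B; split=> /=; lia.
exists ((f, o), (g, p)); split=> //; apply/allpairsP.
  by exists (f, o); split=> //; rewrite mem_iota; rewrite /= in fk *; lia.
by exists (g, p); split=> //; rewrite mem_iota; rewrite /= in gB *; lia.
Qed.

Lemma uniq_heads k B : uniq (heads k B).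
Proof.
by apply: allpairs_uniq => [||[? ?] [? ?] _ _ [-> ->]] //;
   apply: allpairs_uniq => [||[? ?] [? ?] _ _ [-> ->]] //; apply: iota_uniq.
Qed.

Lemma dval_ge h : (h.1.1 + dover h <= dval h)%N.
Proof. by rewrite /dval /dover addnA leq_addr. Qed.

(** The unattached indicator is 1 only when the other summands of [dval] are 0, and then the
    valuation is 1 < i. *)
Lemma dval_lt i h : (2 <= i)%N -> (dval h < i)%N = (h.1.1 + dover h < i)%N.
Proof.
move=> i2; rewrite /dval /dover; case: h => [[f o] [g p]] /=.
by case: f => [|f]; case: o; case: p; rewrite ?andbF ?addn0 //=; case: (0 < g)%N; lia.
Qed.

(** Index 0 would need f = k - 1, hence i = k and f + d = i - 1; but then f + d + i is odd and no 1
    is subtracted. *)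
Lemma next_index_bounds k i h : (i <= k)%N -> (dval h < i)%N ->
  (1 <= next_index k i h <= k)%N.
Proof.
move=> ik hi; have := leq_ltn_trans (dval_ge h) hi.
rewrite /next_index /shifted_index; case: ifP => [_|]; first by lia.
have [e ->] : exists e, k = (i + e)%N by exists (k - i)%N; lia.
move: (dover h) h.1.1 => d f odd_fdi fdi.
have [->|] := posnP e; last by lia.
have : (f + d != i - 1)%N; last by lia.
by apply: contraFneq odd_fdi => ->; rewrite subn1 -[i in X in odd X]prednK ?addnS; lia.
Qed.

Section GeneratingFunction.
Variables (R : comUnitRingType) (k : nat) (a b : fps R).
Hypotheses (k_ge2 : (2 <= k)%N).
Hypotheses (Ua : a \is a GRing.unit) (Ub : b \is a GRing.unit).
Implicit Type x : fps R.

Notation q := (@fpsq R).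

Lemma prefactor_qX x N : eqmodq N.+1 (prefactor a b (x * q ^+ N)) 1.
Proof.
have E (e : fps R) : eqmodq N.+1 (qpoch_inf (e * (x * q ^+ N) * q) q) 1.
  by rewrite mulrA -mulrA -exprSr; apply: qpoch_inf_qX.
have E1 : eqmodq N.+1 (qpoch_inf (x * q ^+ N * q) q) 1.
  by rewrite -mulrA -exprSr; apply: qpoch_inf_qX.
rewrite /prefactor -4!mulNr -[X in eqmodq _ _ X](mulr1 1) -[X in 1 * X]invr1.
apply: eqmodqM.
  by rewrite -(mulr1 1); apply: eqmodqM; apply: E.
apply: eqmodqV; [by rewrite unitrM !qpoch_inf_unit|exact: unitr1|].
by rewrite -(mulr1 1); apply: eqmodqM; [apply: E1|apply: E].
Qed.

Lemma core0 x : core k a b x 0 = ((1 + a * x * q) * (1 + b * x * q))^-1.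
Proof.
have q0 (z p : fps R) : qpoch z p 0 = 1 by rewrite /qpoch big_ord0.
rewrite /core (qpochNS (a * x)) (qpochNS (b * x)) !q0 !muln0 !expr0 !mulr1.
by rewrite !mul1r.
Qed.

(** A factor q^N comes from the power of x q^N and one more q from q^((k-1)(n+1)^2); both exponents
    are positive as k >= 2. *)
Lemma coreS_qX x N n : exists g, core k a b (x * q ^+ N) n.+1 = q ^+ N.+1 * g.
Proof.
rewrite /core exprMn.
have -> : (q ^+ N) ^+ ((k - 1) * n.+1) = q ^+ N * (q ^+ N) ^+ ((k - 1) * n.+1).-1.
  by rewrite -exprS prednK // muln_gt0; lia.
have -> : q ^+ ((k - 1) * n.+1 ^ 2) = q * q ^+ ((k - 1) * n.+1 ^ 2).-1.
  by rewrite -exprS prednK // muln_gt0 expn_gt0; lia.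
rewrite (exprSr q N).
move: (_ ^+ (_ * n.+1).-1) (q ^+ (_ * n.+1 ^ 2).-1) => z1 z2.
move: (q ^+ N) (_ ^+ n.+1) (x ^+ _) => Q z3 z4.
move: (_^-1) (qpoch _ q _ * _) (qpoch _ (q ^+ 2) _) => d u v.
exists (z3 * (z4 * z1) * z2 * u * v * d).
by ring.
Qed.

Lemma Rt_qX x N i : (1 <= i <= k)%N -> eqmodq N.+1 (Rt k i a b (x * q ^+ N)) 1.
Proof.
move=> ik; apply: eqmodq_trans (@Rt_partial _ _ _ _ k_ge2 Ua Ub _ i N.+1 ik) _.
rewrite -[X in eqmodq _ _ X](mulr1 1); apply: eqmodqM; first exact: prefactor_qX.
rewrite big_ord_recl -[X in eqmodq _ _ X]addr0; apply: eqmodqD.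
  (* In the term n = 0 the first half is exactly 1, and the second contains (x q^N)^i q^i with i >=
     1. *)
  rewrite -[nat_of_ord ord0]/0%N (term_core Ua Ub) //.
  rewrite !muln0 !add0n muln1 !expr0 mul1r mulrBr.
  rewrite -[X in eqmodq _ _ X]subr0; apply: eqmodqD.
    rewrite core0 expr1 mulVr // unitrM.
    by rewrite (one_plus_unit (a * (x * q ^+ N)) 0) (one_plus_unit (b * (x * q ^+ N)) 0).
  apply: eqmodqN; case: i ik => // i _; rewrite exprMn !(exprSr _ i).
  move: (x ^+ i) ((q ^+ N) ^+ i) (q ^+ i) => x1 q1 q2.
  have -> : core k a b (x * q ^+ N) 0 *
     (x1 * x * (q1 * q ^+ N) * (q2 * q) * ((a + 1) * (b + 1)))
    = q ^+ N.+1 * (core k a b (x * q ^+ N) 0 * x1 * x * q1 * q2 * ((a + 1) * (b + 1))).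
    by rewrite (exprSr q N); move: (core _ _ _ _ _) => ?; move: (q ^+ N) => *; ring.
  exact: eqmodq_qX.
elim/big_ind: _ => [|u v Hu Hv|n _]; first exact: eqmodq_refl.
  by rewrite -[X in eqmodq _ _ X]addr0; apply: eqmodqD.
rewrite (term_core Ua Ub) // lift0.
have [g ->] := coreS_qX x N n; rewrite -mulrA; exact: eqmodq_qX.
Qed.

Lemma head_weightE y f (o : bool) g (p : bool) :
  head_weight a b y ((f, o), (g, p))
  = (a * b * y) ^+ g * (a ^+ o * b ^+ p * y ^+ (f + (o + p))).
Proof.
rewrite /head_weight /dsize /= !exprMn !exprD.
by move: (a ^+ _) (b ^+ _) (y ^+ _) (a ^+ _) (b ^+ _) (y ^+ _) (y ^+ _) => *; ring.
Qed.

(** For i >= 2 the condition on a head ignores the non-overlined multiplicity g in mu, so the sum is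
    a geometric sum in abxq times [head_sum]. *)
Lemma sum_heads_Rt B x i : (1 <= i <= k)%N ->
  eqmodq B.+1 (Rt k i a b x)
    (\sum_(h <- heads k B | (dval h < i)%N)
        head_weight a b (x * q) h * Rt k (next_index k i h) a b (x * q)).
Proof.
move=> /andP[i1 ik]; have [i2|i_lt2] := leqP 2 i; last first.
  have -> : i = 1%N by lia.
  rewrite (Rt_one k_ge2 Ua Ub) big_mkcond.
  (* For i = 1 the valuation is 0, which leaves only the empty head. *)
  rewrite (bigD1_seq ((0, false), (0, false))%N) ?uniq_heads //;
    last by rewrite mem_heads /=; lia.
  rewrite big1 => [|h]; last first.
    by case: h => [[[|f] [] ] [[|g] []]].
  rewrite /next_index /shifted_index /head_weight /= subn0 !expr0 !mul1r addr0.
  exact: eqmodq_refl.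
(* Extends the sums [head_sum_part] by 0 to all f < k, the range used in [heads]. *)
pose G f d := if (f + d < i)%N then (x * q) ^+ (f + d)
   * Rt k (shifted_index k i f d) a b (x * q) else 0.
have partE d : head_sum_part k a b x i d = \sum_(f < k) G f d.
  rewrite /head_sum_part (big_ord_widen k (fun f => (x * q) ^+ (f + d)
    * Rt k (shifted_index k i f d) a b (x * q))); last first.
    by rewrite (leq_trans (leq_subr _ _)).
  by rewrite big_mkcond; apply: eq_bigr => f _; rewrite /G addnC ltn_subRL.
have -> : \sum_(h <- heads k B | (dval h < i)%N)
      head_weight a b (x * q) h * Rt k (next_index k i h) a b (x * q)
  = (\sum_(g < B.+1) (a * b * (x * q)) ^+ g) * head_sum k a b x i.
  rewrite big_mkcond sum_heads.
  rewrite /head_sum !partE !mulr_sumr -!big_split /= mulr_sumr.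
  apply: eq_bigr => f _; rewrite mulr_suml; apply: eq_bigr => g _.
  rewrite !dval_lt //= !head_weightE /next_index /dover /= /G.
  rewrite !expr0 !expr1 !addn0.
  rewrite add0n -[(1 + 1)%N]/2%N; move: (_ ^+ g) => Y.
  move: (Rt _ (shifted_index k i f 0) _ _ _) (Rt _ (shifted_index k i f 1) _ _ _)
    (Rt _ (shifted_index k i f 2) _ _ _) => r0 r1 r2.
  move: (_ ^+ (f + 2)) (_ ^+ (f + 1)) (_ ^+ f) => x2 x1 x0.
  by do 3!case: ifP => _; ring.
have := Rt_head_sum k_ge2 Ua Ub x (i := i) ltac:(lia).
rewrite (gtn_eqF i2) subr0 => <-.
(* The geometric sum cancels 1 - abxq up to (abxq)^(B+1), which vanishes modulo q^(B+1). *)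
have /(congr1 -%R) := subrX1 (a * b * (x * q)) B.+1.
rewrite opprB; move: (\sum_(g < _) _) => geo E.
have -> : geo * ((1 - a * b * x * q) * Rt k i a b x)
  = (1 - (a * b * (x * q)) ^+ B.+1) * Rt k i a b x.
  by rewrite E; move: (Rt _ _ _ _ _) => *; ring.
rewrite -[X in eqmodq _ X _]mul1r; apply: eqmodqM => //.
rewrite -[X in eqmodq _ X _]subr0; apply: eqmodqD => //; apply: eqmodqN.
by rewrite mulrA exprMn mulrC; apply/eqmodq_sym/eqmodq_qX.
Qed.

Fixpoint config_weight x c : fps R :=
  if c is h :: c' then head_weight a b (x * q) h * config_weight (x * q) c' else 1.

(** Each use of [sum_heads_Rt] replaces x q^N by x q^(N+1); after M of them [Rt_qX] leaves 1 modulo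
    q^(M+N+1). The cut-off in [heads] is harmless because M + N <= B. *)
Lemma Rt_configs B M N x i : (M + N <= B)%N -> (1 <= i <= k)%N ->
  eqmodq (M + N).+1 (Rt k i a b (x * q ^+ N))
    (\sum_(c <- configs k B M | allowed k i c) config_weight (x * q ^+ N) c).
Proof.
elim: M N i => [|M IHM] N i MNB ik.
  by rewrite /= big_mkcond big_seq1; apply: Rt_qX.
have xE : x * q ^+ N * q = x * q ^+ N.+1 by rewrite -mulrA -exprSr.
apply: eqmodq_trans (eqmodqW _ (@sum_heads_Rt B (x * q ^+ N) i ik)) _; first by lia.
rewrite [X in eqmodq _ _ X]big_mkcond /= big_allpairs_dep /= big_mkcond /=.
apply: eqmodq_sum => h _.
case: ifP => [hi|_]; last by rewrite big1.
rewrite -big_mkcond -mulr_sumr; apply: eqmodqM => //.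
rewrite xE addSnnS; apply: IHM; first by lia.
by apply: next_index_bounds => //; lia.
Qed.

End GeneratingFunction.

(** * From configurations to overpartition pairs *)

Lemma mem_configs k B M c :
  (c \in configs k B M) = (size c == M) && all (mem (heads k B)) c.
Proof.
elim: M c => [|M IHM] c; first by case: c.
apply/allpairsP/andP => [[[h c'] [hk c'k ->]]|].
  by move: c'k; rewrite IHM /= eqSS => /andP[-> ->]; rewrite andbT.
case: c => [|h c] [] //= sc /andP[hk ck]; exists (h, c); split=> //.
by rewrite IHM -eqSS sc.
Qed.

Lemma uniq_configs k B M : uniq (configs k B M).
Proof.
elim: M => // M IHM; apply: allpairs_uniq => //; first exact: uniq_heads.
by move=> [? ?] [? ?] _ _ [-> ->].
Qed.

Definition no_part : part_data := ((0, false), (0, false))%N.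

(** Index j stands for the part size j + 1, and the default [no_part] covers the sizes beyond the
    list. *)
Definition config_conditions k i c : Prop :=
  (dval (nth no_part c 0) <= i - 1)%N /\
  forall j, let f := (nth no_part c j).1.1 in let v := dval (nth no_part c j.+1) in
    (f + v <= k - 1)%N /\
    (f + v = k - 1 -> odd (j.+1 * f + j.+2 * v)
      = odd (i - 1 + \sum_(l < j.+1) dover (nth no_part c l)))%N.

(** When f + v = k - 1 the parity condition says that f + d + i is odd, so equality is permitted
    exactly when [shifted_index] equals k - f. *)
Lemma shifted_index_bound k i f d v : (1 <= i)%N -> (f < k)%N ->
  (1 <= shifted_index k i f d)%N ->
  (v <= shifted_index k i f d - 1)%N <->
  (f + v <= k - 1)%N /\ (f + v = k - 1 -> odd (f + 2 * v) = odd (i - 1 + d))%N.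
Proof.
move=> i1 fk; rewrite /shifted_index; case: ifP => odd_fdi; lia.
Qed.

(** This makes the congruence survive the removal of the 1's: d accounts for the overlined parts
    removed, k - 1 for the change of sizes. *)
Lemma odd_shifted_index k i f d : (1 <= i)%N -> (f < k)%N ->
  (1 <= shifted_index k i f d)%N ->
  odd (shifted_index k i f d - 1) = odd (i - 1 + d + (k - 1)).
Proof.
move=> i1 fk; rewrite /shifted_index; case: ifP => odd_fdi; lia.
Qed.

Lemma allowedP k i c : (2 <= k)%N -> (1 <= i <= k)%N ->
  allowed k i c <-> config_conditions k i c.
Proof.
move=> k2; elim: c i => [|h c IHc] i ik.
  have d0 : dval no_part = 0%N by [].
  (* Without parts all valuations are 0, and k >= 2 excludes 0 = k - 1. *)
  by split=> // _; split=> [|j]; rewrite ?nth_nil d0 //= ?muln0; lia.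
suff step : (dval h < i)%N ->
    config_conditions k (next_index k i h) c <-> config_conditions k i (h :: c).
  rewrite /=; split=> [/andP[hi /IHc]|hc].
    by rewrite -step //; apply; apply: next_index_bounds => //; lia.
  have hi : (dval h < i)%N by case: hc => /= hi _; lia.
  rewrite hi /=; apply/IHc; last by apply/step.
  by apply: next_index_bounds => //; lia.
move=> hi; have i'k := next_index_bounds (proj2 (andP ik)) hi.
have fk : (h.1.1 < k)%N by have := dval_ge h; lia.
have i1 : (1 <= i)%N by lia.
have i'1 : (1 <= next_index k i h)%N by lia.
have step0 := shifted_index_bound (dval (nth no_part c 0)) i1 fk i'1.
have := odd_shifted_index i1 fk i'1.
rewrite /config_conditions /= -!/(next_index k i h) => odd_i'.
(* Raising the sizes by 1 adds f + v = k - 1 on the left; by [odd_i'] the parity on the right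
   changes by the same amount. *)
have stepS j : let f := (nth no_part c j).1.1 in let v := dval (nth no_part c j.+1) in
  (f + v = k - 1)%N ->
  (odd (j.+1 * f + j.+2 * v)
     = odd (next_index k i h - 1 + \sum_(l < j.+1) dover (nth no_part c l)))
  <-> (odd (j.+2 * f + j.+3 * v)
     = odd (i - 1 + \sum_(l < j.+2) dover (nth no_part (h :: c) l)))%N.
  have -> : (\sum_(l < j.+2) dover (nth no_part (h :: c) l)
      = dover h + \sum_(l < j.+1) dover (nth no_part c l))%N by rewrite big_ord_recl.
  move: (nth no_part c j).1.1 (dval (nth no_part c j.+1)) => f v /= fv.
  move: (\sum_(l < j.+1) _)%N => s.
  have -> : (j.+2 * f + j.+3 * v = (j.+1 * f + j.+2 * v) + (k - 1))%N by lia.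
  move: (j.+1 * f + j.+2 * v)%N => A; rewrite !(oddD A) (oddD (_ - 1)) odd_i'.
  rewrite (oddD (i - 1 + _)) (oddD (i - 1) (dover h)) (oddD _ (_ + s)) (oddD _ s).
  by case: (odd A); case: (odd s); case: (odd (k - 1)); case: (odd (i - 1));
     case: (odd (dover h)); split.
split=> [[v0 vj]|[_ vj]].
  split=> [|[|j]]; first by lia.
    by rewrite big_ord1 mul1n; apply/step0.
  by have [le_fv odd_fv] := vj j; split=> // fvE; apply/stepS/odd_fv.
split; first by apply/step0; have := vj 0%N; rewrite big_ord1 mul1n.
move=> j; have [le_fv odd_fv] := vj j.+1; split=> // fvE.
by apply/stepS/odd_fv.
Qed.


Lemma eq_mod2 (m n : nat) : (m = n %[mod 2])%N <-> odd m = odd n.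
Proof. by rewrite !modn2; split=> [|->] //; case: (odd m); case: (odd n). Qed.

(* The overpartition with [f] non-overlined parts and [o] overlined parts of size
   [N + l + 1], where [(f, o)] is the [l]-th entry of [u]. *)
Fixpoint parts_of N (u : seq (nat * bool)) : seq (nat * bool) :=
  if u is (f, o) :: u' then
    parts_of N.+1 u' ++ (nseq o (N.+1, true) ++ nseq f (N.+1, false))
  else [::].

Lemma count_nseqC (P : pred (nat * bool)) (n : nat) x :
  count P (nseq n x) = (n * P x)%N.
Proof. by rewrite count_nseq mulnC. Qed.

Lemma parts_of_gt N u : all (fun y => N < y.1)%N (parts_of N u).
Proof.
elim: u N => // -[f o] u IHu N /=; rewrite !all_cat !all_nseq /= ltnSn !orbT !andbT.
by apply: sub_all (IHu N.+1) => y /ltnW.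
Qed.

Lemma overpart_step_trans : transitive overpart_step.
Proof.
by move=> [y b] [x a] [z c]; rewrite /overpart_step /=; case: a; case: b; case: c; lia.
Qed.

Lemma overpart_step_anti : antisymmetric overpart_step.
Proof.
move=> [x a] [y b]; rewrite /overpart_step /= => xy.
by have [-> ->] : x = y /\ a = b by case: a b xy => -[]; lia.
Qed.

(** As [overpart_step] is transitive, sortedness is a pairwise condition and can be checked block by
    block. *)
Lemma parts_ofP N u : is_overpartition (parts_of N u).
Proof.
apply/andP; split; first by apply: sub_all (parts_of_gt N u) => y; lia.
rewrite (sorted_pairwise overpart_step_trans).
elim: u N => // -[f o] u IHu N /=; rewrite !pairwise_cat IHu /=.
rewrite allrel_catr; apply/and3P; split.
- apply/andP; split; apply/allrelP => y z /(allP (parts_of_gt _ _)) /= Ny;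
    by rewrite mem_nseq => /andP[_ /eqP->]; rewrite /overpart_step /= Ny.
- by apply/allrelP => y z; rewrite !mem_nseq => /andP[_ /eqP->] /andP[_ /eqP->];
     rewrite /overpart_step /= eqxx orbT.
rewrite -!(sorted_pairwise overpart_step_trans); apply/andP; split.
  by case: o.
by elim: f => // -[|f] //= ->; rewrite /overpart_step eqxx orbT.
Qed.

Definition overpart_of u := Overpartition (parts_ofP 0 u).

Lemma count_parts_of (P : pred (nat * bool)) N u : count P (parts_of N u) =
  (\sum_(l < size u) ((nth (0, false) u l).2 * P ((N + l).+1, true)
    + (nth (0, false) u l).1 * P ((N + l).+1, false)))%N.
Proof.
elim: u N => [|[f o] u IHu] N; first by rewrite big_ord0.
rewrite /= !count_cat !count_nseqC IHu big_ord_recl addn0 addnC /=.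
by congr addn; apply: eq_bigr => l _; rewrite /bump /= addnCA add1n.
Qed.

Lemma sum_delta n j (F : nat -> nat) :
  (\sum_(l < n) F l * (nat_of_ord l == j) = (j < n) * F j)%N.
Proof.
have [jn|nj] := ltnP j n.
  rewrite (bigD1 (Ordinal jn)) //= eqxx muln1 mul1n big1 ?addn0 // => l.
  by rewrite -val_eqE => /negbTE /= ->; rewrite muln0.
by rewrite big1 // => l _; rewrite ltn_eqF ?muln0 // (leq_trans (ltn_ord l)).
Qed.

Lemma nth_mul_size (T : Type) (x0 : T) (F : T -> nat) u j : F x0 = 0%N ->
  ((j < size u) * F (nth x0 u j) = F (nth x0 u j))%N.
Proof.
by move=> F0; case: ltnP => uj; rewrite ?mul1n // nth_default // F0.
Qed.

Lemma fr_overpart_of u j : fr (overpart_of u) j.+1 = (nth (0, false)%N u j).1.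
Proof.
rewrite /fr /= count_parts_of -[RHS](@nth_mul_size _ (0, false)%N fst) //.
rewrite -(sum_delta _ _ (fun l => (nth (0, false)%N u l).1)).
apply: eq_bigr => l _; rewrite /= !add0n.
by rewrite !xpair_eqE andbF andbT eqSS muln0 add0n.
Qed.

Lemma fr_over_overpart_of u j :
  fr_over (overpart_of u) j.+1 = (nth (0, false)%N u j).2.
Proof.
rewrite /fr_over /= count_parts_of.
rewrite -[RHS](@nth_mul_size _ (0, false)%N (fun y => nat_of_bool y.2)) //.
rewrite -(sum_delta _ _ (fun l => nat_of_bool (nth (0, false)%N u l).2)).
apply: eq_bigr => l _; rewrite /= !add0n.
by rewrite !xpair_eqE andbF andbT eqSS muln0 addn0.
Qed.

Lemma over_le_overpart_of u j :
  over_le (overpart_of u) j = (\sum_(l < j) (nth (0, false)%N u l).2)%N.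
Proof.
rewrite /over_le /= count_parts_of.
rewrite (big_ord_widen (size u + j) (fun l => (nth (0, false) u l).2
  * (l.+1 <= j) + (nth (0, false) u l).1 * 0)%N) ?leq_addr //.
rewrite (big_ord_widen (size u + j) (fun l => nat_of_bool (nth (0, false)%N u l).2))
  ?leq_addl //.
rewrite big_mkcond [RHS]big_mkcond; apply: eq_bigr => l _.
rewrite muln0 addn0; case: ltnP => lu; first by case: ltnP; rewrite ?muln1 ?muln0.
by rewrite nth_default // if_same.
Qed.

Lemma count_flag_parts_of (Q : pred bool) N u :
  count (fun y => Q y.2) (parts_of N u)
  = (\sum_(y <- u) (y.2 * Q true + y.1 * Q false))%N.
Proof.
elim: u N => [|[f o] u IHu] N; first by rewrite big_nil.
by rewrite big_cons /= !count_cat !count_nseqC IHu addnC.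
Qed.

Lemma overpartition_le_weight (l : overpartition) y :
  y \in parts l -> (y.1 <= weight l)%N.
Proof.
rewrite /weight; elim: (parts l) => //= z s IHs; rewrite inE => /predU1P[->|/IHs].
  exact: leq_addr.
by move=> ys; apply: leq_trans ys (leq_addl _ _).
Qed.

Lemma part_pos (l : overpartition) y : y \in parts l -> (0 < y.1)%N.
Proof. by case/andP: (partsP l) => /allP H _ /H. Qed.

Lemma size_le_weight (l : overpartition) : (size l <= weight l)%N.
Proof.
rewrite /weight; have := @part_pos l; elim: (parts l) => //= y s IHs ys.
have := IHs (fun z zs => ys z (@mem_behead _ (y :: s) z zs)).
by have := ys y (mem_head _ _); lia.
Qed.

Lemma fr_over_le1 (l : overpartition) j : (fr_over l j <= 1)%N.
Proof.
case/andP: (partsP l) => _; rewrite (sorted_pairwise overpart_step_trans) /fr_over.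
elim: (parts l) => //= y s IHs /andP[ys /IHs]; case: eqP => [yE|_]; last by rewrite add0n.
rewrite (_ : count_mem (j, true) s = 0%N) //; apply/count_memPn/negP => js.
by have := allP ys _ js; rewrite yE /overpart_step /= ltnn andbF.
Qed.

(** A list sorted for a transitive antisymmetric relation is determined by its multiplicities. *)
Lemma overpart_ofK n (l : overpartition) : (weight l <= n)%N ->
  overpart_of [seq (fr l j.+1, 0 < fr_over l j.+1)%N | j <- iota 0 n] = l.
Proof.
move=> ln; set u := map _ _; apply: val_inj.
have srt (l' : overpartition) : sorted overpart_step l' by case/andP: (partsP l').
apply: (sorted_eq overpart_step_trans overpart_step_anti) => //.
have nth_u j : (j < n)%N -> nth (0, false)%N u j = (fr l j.+1, 0 < fr_over l j.+1)%N.
  by move=> jn; rewrite (nth_map 0%N) ?size_iota // nth_iota // add0n.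
have big0 j b : (n <= j)%N -> count_mem (j.+1, b) l = 0%N.
  move=> nj; apply/count_memPn/negP => /overpartition_le_weight /=; lia.
(* Size 0 occurs on neither side, nor do sizes above n. *)
apply/allP => -[[|j] b] _ /=; apply/eqP.
  have z (l' : overpartition) : count_mem (0%N, b) l' = 0%N.
    by apply/count_memPn/negP => /part_pos.
  by rewrite (z l); apply: z (overpart_of u).
have uE : count_mem (j.+1, b) (parts_of 0 u)
   = if b then nat_of_bool (nth (0, false)%N u j).2 else (nth (0, false)%N u j).1.
  by case: b; [apply: fr_over_overpart_of|apply: fr_overpart_of].
rewrite uE; have [jn|nj] := ltnP j n.
  rewrite nth_u //=; case: b {uE} => //.
  by have := fr_over_le1 l j.+1; rewrite -/(fr_over l j.+1); case: (fr_over _ _) => [|[]].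
by rewrite big0 // nth_default ?size_map ?size_iota //; case: b {uE}.
Qed.

(** * The pair attached to a configuration *)

Definition pair_of c : overpartition * overpartition :=
  (overpart_of [seq h.1 | h <- c], overpart_of [seq h.2 | h <- c]).

Lemma nth_fst c j : nth (0, false)%N [seq h.1 | h <- c] j = (nth no_part c j).1.
Proof.
have [jc|cj] := ltnP j (size c); first by rewrite (nth_map no_part).
by rewrite !nth_default ?size_map.
Qed.

Lemma nth_snd c j : nth (0, false)%N [seq h.2 | h <- c] j = (nth no_part c j).2.
Proof.
have [jc|cj] := ltnP j (size c); first by rewrite (nth_map no_part).
by rewrite !nth_default ?size_map.
Qed.

Lemma valuation_pair_of c j :
  valuation (pair_of c).1 (pair_of c).2 j.+1 = dval (nth no_part c j).
Proof.
by rewrite /valuation /unattached !fr_overpart_of !fr_over_overpart_of nth_fst nth_snd.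
Qed.

Lemma pair_conditions_pair_of k i c : (2 <= k)%N -> (1 <= i <= k)%N ->
  pair_conditions k i (pair_of c) <-> allowed k i c.
Proof.
move=> k2 ik; rewrite (allowedP c k2 ik).
have overE j : (over_le (pair_of c).1 j + over_le (pair_of c).2 j
    = \sum_(l < j) dover (nth no_part c l))%N.
  rewrite !over_le_overpart_of -big_split /=; apply: eq_bigr => l _.
  by rewrite nth_fst nth_snd.
have frE j : fr (pair_of c).1 j.+1 = (nth no_part c j).1.1.
  by rewrite fr_overpart_of nth_fst.
split=> [[]|[v0 vj]].
  rewrite valuation_pair_of => v0 le_fv mod_fv; split=> // j f v.
  have := le_fv j.+1 isT; have := mod_fv j.+1 isT.
  by rewrite -addnA overE frE valuation_pair_of eq_mod2.
split; first by rewrite valuation_pair_of.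
  by case=> // j _; rewrite frE valuation_pair_of; case: (vj j).
case=> // j _; rewrite -addnA overE frE valuation_pair_of eq_mod2.
by case: (vj j).
Qed.

(** The offset [N] is that of [parts_of]: the first entry describes parts of size N + 1. *)
Fixpoint config_size N c : nat :=
  if c is h :: c' then (N.+1 * dsize h + config_size N.+1 c')%N else 0%N.

Definition exponent_a c := (\sum_(h <- c) (h.1.2 + h.2.1))%N.
Definition exponent_b c := (\sum_(h <- c) (h.2.1 + h.2.2))%N.
Definition exponent_x c := (\sum_(h <- c) dsize h)%N.

Lemma weight_parts_of N c :
  (sumn [seq y.1 | y <- parts_of N [seq h.1 | h <- c]]
   + sumn [seq y.1 | y <- parts_of N [seq h.2 | h <- c]] = config_size N c)%N.
Proof.
elim: c N => // -[[f o] [g p]] c IHc N /=.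
rewrite -IHc !map_cat !sumn_cat !map_nseq !sumn_nseq /= /dsize /=; nia.
Qed.

Lemma pair_statistics_pair_of s t m n c : pair_statistics s t m n (pair_of c) <->
  [/\ config_size 0 c = n, exponent_x c = m, exponent_a c = s & exponent_b c = t].
Proof.
have sizeE u : size (overpart_of u) = (\sum_(y <- u) (y.1 + y.2))%N.
  rewrite /= -count_predT (@count_flag_parts_of xpredT).
  by apply: eq_bigr => y _; rewrite !muln1 addnC.
rewrite /pair_statistics /=; rewrite /weight weight_parts_of /num_over /num_nonover /=.
rewrite (@count_flag_parts_of id) (@count_flag_parts_of negb).
rewrite !(sizeE [seq _ | _ <- _]) !big_map -!big_split /=.
rewrite /exponent_x /exponent_a /exponent_b.
have -> : (\sum_(h <- c) ((h.1.2 * 1 + h.1.1 * 0) + (h.2.2 * 0 + h.2.1 * 1))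
  = \sum_(h <- c) (h.1.2 + h.2.1))%N.
  by apply: eq_bigr => h _; rewrite !muln0 !muln1 addn0.
by [].
Qed.

(** * Coefficients *)

(** The length is fixed because trailing [no_part] entries leave no trace in the pair; all other
    data are read off from its multiplicities. *)
Lemma pair_of_inj n : {in [pred c | size c == n] &, injective pair_of}.
Proof.
move=> c c' /eqP sc /eqP sc' cc'; apply: (@eq_from_nth _ no_part) => [|j _].
  by rewrite sc sc'.
have E d : nth no_part d j = ((fr (pair_of d).1 j.+1, 0 < fr_over (pair_of d).1 j.+1),
    (fr (pair_of d).2 j.+1, 0 < fr_over (pair_of d).2 j.+1))%N.
  rewrite !fr_overpart_of !fr_over_overpart_of nth_fst nth_snd.
  by case: (nth no_part d j) => [[f o] [g p]]; case: o; case: p.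
by rewrite E cc' -E.
Qed.

(** Condition (ii) keeps the non-overlined multiplicities in lambda below k; the weight bounds those
    in mu and all part sizes by n. *)
Lemma pair_ofP k i n lm : pair_conditions k i lm ->
  (weight lm.1 + weight lm.2 <= n)%N -> (0 < k)%N ->
  exists2 c, c \in configs k n n & lm = pair_of c.
Proof.
case: lm => la mu [_ le_fv _] /= ln k0.
exists [seq ((fr la j.+1, 0 < fr_over la j.+1), (fr mu j.+1, 0 < fr_over mu j.+1))%N
       | j <- iota 0 n].
  rewrite mem_configs size_map size_iota eqxx; apply/allP => h /mapP[j _ ->].
  rewrite /= mem_heads /=; have := le_fv j.+1 isT.
  have : (fr mu j.+1 <= size mu)%N by apply: count_size.
  by have := size_le_weight mu; lia.
by rewrite /pair_of -!map_comp !overpart_ofK //; lia.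
Qed.

Section Coefficients.
Variable R : comUnitRingType.
Notation q := (@fpsq R).

Lemma fpsCM (u v : R) : fpsC (u * v) = fpsC u * fpsC v.
Proof.
apply: fpsP => n; rewrite fcoefM big_ord_recl subn0 big1 ?addr0 => [|l _].
  by rewrite /=; case: ifP; rewrite ?mulr0.
by rewrite /= mul0r.
Qed.

Lemma fpsCX (u : R) n : fpsC (u ^+ n) = fpsC u ^+ n.
Proof. by elim: n => // n IHn; rewrite !exprS fpsCM IHn. Qed.

Lemma fcoef_fpsCM (u : R) (f : fps R) n : (fpsC u * f) n = u * f n.
Proof.
rewrite fcoefM big_ord_recl subn0 big1 ?addr0 // => l _.
by rewrite /= mul0r.
Qed.

Lemma fcoef_qX w n : (q ^+ w) n = (w == n)%:R.
Proof.
elim: w n => [|w IHw] n; first by rewrite expr0 fcoef1; case: n.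
rewrite exprS fcoefM; case: n => [|n].
  by rewrite big_ord1 mul0r.
rewrite big_ord_recl mul0r add0r big_ord_recl /= mul1r subn1 IHw big1 ?addr0 //.
by move=> l _; rewrite mul0r.
Qed.

Lemma fcoef_sum (I : Type) (r : seq I) (P : pred I) (F : I -> fps R) n :
  (\sum_(j <- r | P j) F j) n = \sum_(j <- r | P j) F j n.
Proof. exact: (big_morph (fun f : fps R => f n) (fun f g => fcoefD f g n)). Qed.

Lemma config_weightE (a b x : fps R) N c : config_weight a b (x * q ^+ N) c =
  a ^+ exponent_a c * b ^+ exponent_b c * x ^+ exponent_x c * q ^+ config_size N c.
Proof.
elim: c N => [|h c IHc] N.
  by rewrite /exponent_a /exponent_b /exponent_x !big_nil !expr0 !mulr1.
rewrite /exponent_a /exponent_b /exponent_x !big_cons.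
rewrite -/(exponent_a c) -/(exponent_b c) -/(exponent_x c) [LHS]/=.
have -> : x * q ^+ N * q = x * q ^+ N.+1 by rewrite -mulrA -exprSr.
rewrite IHc [config_size _ _]/= /head_weight exprMn -exprM !exprD.
move: (a ^+ _) (a ^+ _) (a ^+ _) (b ^+ _) (b ^+ _) (b ^+ _) => *.
by move: (x ^+ _) (x ^+ _) (q ^+ _) (q ^+ _) => *; ring.
Qed.

End Coefficients.

Definition config_monomial c : 'X_{1.. 3} :=
  [multinom [tuple exponent_a c; exponent_b c; exponent_x c]].

Lemma config_monomialE c : 'X_[config_monomial c]
  = 'X_0 ^+ exponent_a c * 'X_1 ^+ exponent_b c * 'X_(2%:R) ^+ exponent_x c
    :> {mpoly int[3]}.
Proof.
rewrite [LHS]mpolyXE_id !big_ord_recl big_ord0 mulr1 mulrA !(mnm_nth 0%N) /=.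
by do ![congr (_ * _)]; congr ('X_ _ ^+ _); apply: val_inj.
Qed.

(** [Rt_configs] with N = 0 and M = B = n holds modulo q^(n+1), hence gives the coefficient of q^n
    exactly. *)
Lemma Rt_abx_coef k i n : (2 <= k)%N -> (1 <= i <= k)%N ->
  Rt_abx k i n = (\sum_(c <- configs k n n | allowed k i c && (config_size 0 c == n))
                    'X_[config_monomial c] : {mpoly int[3]})%:F.
Proof.
move=> k2 ik.
have := @Rt_configs _ k (indet 0) (indet 1) k2 (indet_unit _) (indet_unit _)
  n n 0 (indet 2%:R) i; rewrite addn0 expr0 mulr1 => /(_ (leqnn n) ik n (ltnSn n)).
rewrite -/(Rt_abx k i) => ->; rewrite fcoef_sum big_mkcondr rmorph_sum /=.
apply: eq_bigr => c _.
have := config_weightE (indet 0) (indet 1) (indet 2%:R) 0 c.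
rewrite expr0 mulr1 => ->; rewrite /indet -!fpsCX -!fpsCM fcoef_fpsCM fcoef_qX.
rewrite -!rmorphXn -!rmorphM /= -config_monomialE.
by case: eqP => _; rewrite ?mulr1 ?mulr0 ?rmorph0.
Qed.

Lemma config_monomial_eq c s t m : (config_monomial c == [multinom [tuple s; t; m]])
  = [&& exponent_a c == s, exponent_b c == t & exponent_x c == m].
Proof.
apply/eqP/and3P => [E|[/eqP<- /eqP<- /eqP<-] //].
have E' j : config_monomial c j = [multinom [tuple s; t; m]] j by rewrite E.
have := E' 0; have := E' 1; have := E' 2%:R; rewrite !(mnm_nth 0%N) /=.
by move=> -> -> ->; rewrite !eqxx.
Qed.

Theorem theorem2 (k i : nat) (hk : (2 <= k)%N) (hi : (1 <= i <= k)%N) :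
  exists r : nat -> nat -> nat -> nat -> nat,
    has_expansion (Rt_abx k i) (fun s t m n => Posz (r s t m n)) /\
    forall s t m n : nat,
      has_card (fun lm => pair_statistics s t m n lm /\ pair_conditions k i lm)
               (r s t m n).
Proof.
(* The good configurations of length n yield the monomials of the expansion, and [pair_of] maps them
   bijectively to the pairs. *)
pose good s t m n c := [&& allowed k i c && (config_size 0 c == n),
  exponent_a c == s, exponent_b c == t & exponent_x c == m].
exists (fun s t m n => count (good s t m n) (configs k n n)); split.
  move=> n; eexists; first exact: Rt_abx_coef.
  move=> s t m; rewrite raddf_sum /= -sum1_count -natz natr_sum.
  rewrite [RHS]big_mkcondr.
  by apply: eq_bigr => c _; rewrite mcoeffX config_monomial_eq; case: ifP.
move=> s t m n.
exists [seq pair_of c | c <- configs k n n & good s t m n c]; split.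
- rewrite map_inj_in_uniq ?filter_uniq ?uniq_configs // => c c'.
  rewrite !mem_filter !mem_configs => /and3P[_ sc _] /and3P[_ sc' _].
  exact: (@pair_of_inj n).
- move=> lm; have goodE c : good s t m n c <->
      pair_statistics s t m n (pair_of c) /\ pair_conditions k i (pair_of c).
    rewrite pair_statistics_pair_of pair_conditions_pair_of // /good; split.
      by case/and4P => /andP[-> /eqP->] /eqP-> /eqP-> /eqP->.
    by case=> -[-> -> -> ->] ->; rewrite !eqxx.
  split=> [/mapP[c]|]; first by rewrite mem_filter => /andP[/goodE gc _] ->.
  move=> lmP; have [stat cond] := lmP.
  have wn : (weight lm.1 + weight lm.2 = n)%N by case: lm stat {lmP cond} => ? ? [].
  have [|c cn lmE] := @pair_ofP k i n lm cond _ ltac:(lia); first by rewrite wn.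
  apply/mapP; exists c => //; rewrite mem_filter cn andbT.
  by apply/goodE; rewrite -lmE.
by rewrite size_map size_filter.
Qed.
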